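(* Let $f:\mathbb{N}\rightarrow \mathbb{R}$ be a gently growing function. Then there exists a sequence $(p_k)_{k\in \mathbb{N}}$ of primes such that the infinitely iterated wreath product with respect to product actions $W^{\mathrm{pa}}(\mathcal{P})$ of type $\mathcal{P} = (\mathrm{PSL}_2(\mathbb{F}_{p_k}))_{k\in \mathbb{N}}$, where $\mathrm{PSL}_2(\mathbb{F}_{p_k})$ is regarded as a permutation group via its natural action on the projective line $\mathbb{P}^1(\mathbb{F}_{p_k})$, has subgroup growth type $n^{f(n)}$.
   Context: $\mathbb{N}=\{1,2,3,\dots\}$. Gently growing: a function $f:\mathbb{N}\to\mathbb{R}$ is gently growing if $f$ is unbounded, non-decreasing, positive, and there exist constants $A,N>0$ such that $f(\lfloor x^{\log x}\rfloor)\le A f(x)$ for all $x\in\mathbb{N}$ with $x\ge N$ ($\log$ is the logarithm to a fixed base, e.g. natural). Subgroup growth type: for a finitely generated profinite group $G$ and a positive integer $n$, $s_n(G)$ denotes the number of open subgroups of index at most $n$ in $G$. Given $g:\mathbb{N}\to\mathbb{R}$, $G$ has subgroup growth type $g$ if there are constants $b,c>0$ such that $s_n(G)\le g(n)^b$ for all sufficiently large $n$ and $s_n(G)\ge g(n)^c$ for infinitely many $n$. Product action: for $A\le \mathrm{Sym}(\Omega)$ and $B\le\mathrm{Sym}(\Delta)$, with $\Omega$ and $\Delta$ finite, the wreath product of $A$ by $B$ with respect to product action is the wreath product $A^{\Delta}\rtimes B$ (with $B$ permuting the coordinates via its action on $\Delta$) acting on the set $\Omega^{\Delta}$ of functions $\Delta\to\Omega$: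 the base group $A^{\Delta}$ acts coordinatewise and $B$ acts by permuting the coordinates. Infinitely iterated wreath product: let $\mathcal{S}=(S_k)_{k\in\mathbb{N}}$ be a sequence of finite transitive permutation groups $S_k\le\mathrm{Sym}(\Omega_k)$. Let $\widehat{\Omega}_0$ be a one-point set and $\widehat{\Omega}_n=\Omega_n^{\widehat{\Omega}_{n-1}}$ for $n\ge1$ (so $\widehat\Omega_1$ is identified with $\Omega_1$). Put $W^{\mathrm{pa}}_1=S_1\le\mathrm{Sym}(\widehat\Omega_1)$ and, for $n\ge 2$, let $W^{\mathrm{pa}}_n\le\mathrm{Sym}(\widehat{\Omega}_n)$ be the wreath product with respect to product action of $S_n\le \mathrm{Sym}(\Omega_n)$ by $W^{\mathrm{pa}}_{n-1}\le\mathrm{Sym}(\widehat{\Omega}_{n-1})$. The infinitely iterated wreath product of type $\mathcal{S}$ with respect to product actions is the profinite group $W^{\mathrm{pa}}(\mathcal{S})=\varprojlim W^{\mathrm{pa}}_n$, the inverse limit along the natural projections $W^{\mathrm{pa}}_n\to W^{\mathrm{pa}}_{n-1}$ with kernel the base group $S_n^{\widehat{\Omega}_{n-1}}$. *)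

(* Defs.v *)
From HB Require Import structures.
From mathcomp Require Import all_boot all_order all_algebra all_fingroup.
From mathcomp Require Import all_solvable finmap.
From mathcomp Require Import all_classical all_reals all_analysis.

Set Implicit Arguments.
Unset Strict Implicit.
Unset Printing Implicit Defensive.

Section ProjectiveLine.
Local Open Scope ring_scope.
Import GRing.Theory.
Variable F : finFieldType.

Definition is_line (L : {set 'rV[F]_2}) : bool :=
  [exists v : 'rV[F]_2, (v != 0) && (L == [set c *: v | c : F])].

(* The projective line: the one-dimensional subspaces of F^2, as sets of row
   vectors, with matrices acting on the right. *)
Definition P1 : finType := {L : {set 'rV[F]_2} | is_line L}.

Lemma P1_act_subproof (L : P1) (g : {'GL_2[F]}) :
  is_line [set v *m GLval g | v in val L].
Proof.
have /existsP[v /andP[v0 /eqP ->]] := valP L.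
apply/existsP; exists (v *m GLval g); apply/andP; split.
  apply: contra v0 => /eqP vg0.
  by rewrite -(mulmxK (GL_unitmx g) v) vg0 mul0mx.
apply/eqP/setP=> w; apply/imsetP/imsetP => [[_ /imsetP[c _ ->] ->]|[c _ ->]].
  by exists c => //; rewrite scalemxAl.
by exists (c *: v); [exact: imset_f | rewrite scalemxAl].
Qed.

Definition P1_act_fun (L : P1) (g : {'GL_2[F]}) : P1 :=
  exist is_line [set v *m GLval g | v in val L] (P1_act_subproof L g).

Lemma P1_act1 : P1_act_fun^~ 1%g =1 id.
Proof.
move=> L; apply: val_inj => /=; apply/setP=> w; apply/imsetP/idP.
  by move=> [v vL ->]; rewrite mulmx1.
by move=> wL; exists w; rewrite ?mulmx1.
Qed.

Lemma P1_actM L : act_morph P1_act_fun L.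
Proof.
move=> g h; apply: val_inj => /=; apply/setP=> w; apply/imsetP/imsetP.
  move=> [v vL ->]; exists (v *m GLval g); first exact: imset_f.
  by rewrite -mulmxA.
by move=> [_ /imsetP[v vL ->] ->]; exists v => //; rewrite -mulmxA.
Qed.

Canonical P1_act : {action {'GL_2[F]} &-> P1} := TotalAction P1_act1 P1_actM.

Definition SL2 : {set {'GL_2[F]}} := [set g | \det (GLval g) == 1].

Lemma SL2_group_set : group_set SL2.
Proof.
apply/group_setP; split=> [|g h]; first by rewrite inE GL_1E det1.
by rewrite !inE GL_ME det_mulmx => /eqP-> /eqP->; rewrite mulr1.
Qed.
Canonical SL2_group := Group SL2_group_set.

(* PSL_2(F) inside Sym(P^1(F)), as the image of SL_2(F) in Sym(P^1(F)): the
   kernel of the action is the centre of SL_2(F) (ker_actperm_P1), so this is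
   isomorphic to SL_2(F) / Z(SL_2(F)) (PSL2_P1_isog). *)
Definition PSL2_P1 : {set {perm P1}} := (actperm P1_act @* SL2)%g.
Canonical PSL2_P1_group := [group of PSL2_P1].

Lemma scalar_mx22 (M : 'M[F]_2) :
  M 0 1 = 0 -> M 1 0 = 0 -> M 0 0 = M 1 1 -> M = (M 0 0)%:M.
Proof.
move=> h01 h10 h; apply/matrixP=> i j.
have h2 (k : 'I_2) : (k = 0) \/ (k = 1).
  by case: k => [[|[|k]] hk] //; [left|right]; apply: val_inj.
by rewrite mxE; case: (h2 i) => ->; case: (h2 j) => -> //=; rewrite ?mulr1n.
Qed.

Lemma det_mx22 (M : 'M[F]_2) : \det M = M 0 0 * M 1 1 - M 0 1 * M 1 0.
Proof.
rewrite (expand_det_row _ 0) !big_ord_recl big_ord0 /cofactor !det_mx11 !mxE /=.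
rewrite addr0 expr0 expr1 mul1r mulN1r mulrN.
by congr (_ * M _ _ - M _ _ * M _ _); apply: val_inj.
Qed.

Lemma P1_act_ker_scalar (g : {'GL_2[F]}) :
  (forall L, P1_act L g = L) <-> exists a, GLval g = a%:M.
Proof.
split=> [fixg|[a ga] L].
  have eig (v : 'rV[F]_2) : v != 0 -> exists a, v *m GLval g = a *: v.
    move=> v0.
    have Lv : is_line [set c *: v | c : F].
      by apply/existsP; exists v; rewrite v0 eqxx.
    have vL : v \in [set c *: v | c : F].
      by apply/imsetP; exists 1; rewrite ?scale1r.
    have /(congr1 val)/= fixv := fixg (exist is_line _ Lv).
    have : v *m GLval g \in [set u *m GLval g | u in [set c *: v | c : F]].
      by apply/imsetP; exists v.
    by rewrite fixv => /imsetP[a _ ->]; exists a.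
  have nz (v : 'rV[F]_2) i : v 0 i = 1 -> v != 0.
    by move=> vi; apply/eqP => /matrixP/(_ 0 i)/eqP; rewrite vi mxE oner_eq0.
  pose e (i : 'I_2) : 'rV[F]_2 := delta_mx 0 i.
  have e1 i : e i 0 i = 1 by rewrite mxE !eqxx.
  have [a ha] := eig _ (nz _ _ (e1 0)).
  have [b hb] := eig _ (nz _ _ (e1 1)).
  have s0 : (e 0 + e 1) 0 0 = 1 by rewrite !mxE /= addr0.
  have [c hc] := eig _ (nz _ _ s0).
  have r i j : (e i *m GLval g) 0 j = GLval g i j.
    by rewrite -rowE mxE.
  move: hc; rewrite mulmxDl => hc.
  have g00 : GLval g 0 0 = a by rewrite -r ha !mxE /= mulr1.
  have g01 : GLval g 0 1 = 0 by rewrite -r ha !mxE /= mulr0.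
  have g10 : GLval g 1 0 = 0 by rewrite -r hb !mxE /= mulr0.
  have g11 : GLval g 1 1 = b by rewrite -r hb !mxE /= mulr1.
  exists a; rewrite -g00; apply: scalar_mx22 => //.
  have q j : GLval g 0 j + GLval g 1 j = c * (e 0 0 j + e 1 0 j).
    rewrite -!r; have := congr1 (fun v : 'rV_2 => v 0 j) hc.
    by rewrite /= !mxE.
  have := q 1; have := q 0; rewrite g00 g01 g10 g11 !e1 !mxE /=.
  by rewrite !addr0 !add0r !mulr1 => -> ->.
apply: val_inj => /=; apply/setP=> w.
have a0 : a != 0.
  by apply: contraTneq (GL_det g) => a0; rewrite ga a0 det_scalar expr0n negbK.
have /existsP[v /andP[v0 /eqP ->]] := valP L.
apply/imsetP/imsetP => [[_ /imsetP[c _ ->] ->]|[c _ ->]].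
  by exists (a * c) => //; rewrite ga mul_mx_scalar scalerA.
exists ((c / a) *: v); first exact: imset_f.
by rewrite ga mul_mx_scalar scalerA mulrC divfK.
Qed.


Lemma SL2_mem_ex (M : 'M[F]_2) : \det M = 1 ->
  exists2 g, g \in SL2 & GLval g = M.
Proof.
move=> dM; have uM : M \is a GRing.unit by rewrite unitmxE dM unitr1.
by exists (FinRing.unit _ uM) => //; rewrite inE /= dM.
Qed.

Lemma ker_actperm_P1 : ('ker_SL2 (actperm P1_act) = 'Z(SL2))%g.
Proof.
apply/setP=> g; rewrite !inE /=; case gS: (\det _ == 1) => //=.
have gS' : g \in SL2 by rewrite inE gS.
apply/eqP/centP => [gk h hS|gC].
  have /P1_act_ker_scalar[a ga] : forall L, P1_act L g = L.
    by move=> L; rewrite -actpermE gk perm1.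
  apply: val_inj; change (GLval g *m GLval h = GLval h *m GLval g).
  by rewrite ga scalar_mxC.
suff [a ga] : exists a, GLval g = a%:M.
  apply/permP=> L; rewrite actpermE perm1.
  by have /P1_act_ker_scalar -> : exists a, GLval g = a%:M by exists a.
pose E (i j : 'I_2) : 'M[F]_2 := 1%:M + delta_mx i j.
have com i j : \det (E i j) = 1 -> GLval g *m delta_mx i j = delta_mx i j *m GLval g.
  move=> /SL2_mem_ex[h hS hE].
  have : GLval (g * h)%g = GLval (h * g)%g by rewrite (gC _ hS).
  by rewrite !GL_MxE hE mulmxDr mulmxDl mulmx1 mul1mx => /addrI.
have d01 : \det (E 0 1) = 1.
  by rewrite det_mx22 !mxE /= ?mulr1n ?mulr0n !addr0 !add0r !mulr1 mulr0 subr0.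
have d10 : \det (E 1 0) = 1.
  by rewrite det_mx22 !mxE /= ?mulr1n ?mulr0n !addr0 !add0r !mulr1 subr0.
have c01 := com _ _ d01.
have c10 := com _ _ d10.
have m1 (i j k l : 'I_2) : (GLval g *m delta_mx i j) k l = GLval g k i *+ (l == j).
  rewrite mxE (bigD1 i) //= big1 => [|m mi]; last first.
    by rewrite mxE (negbTE mi) mulr0.
  by rewrite mxE eqxx addr0 mulr_natr.
have m2 (i j k l : 'I_2) : (delta_mx i j *m GLval g) k l = GLval g j l *+ (k == i).
  rewrite mxE (bigD1 j) //= big1 => [|m mi]; last first.
    by rewrite mxE (negbTE mi) andbF mul0r.
  by rewrite mxE eqxx andbT addr0 mulr_natl.
have q01 (k l : 'I_2) : GLval g k 0 *+ (l == 1) = GLval g 1 l *+ (k == 0).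
  by have := m1 0 1 k l; rewrite c01 m2.
have q10 (k l : 'I_2) : GLval g k 1 *+ (l == 0) = GLval g 0 l *+ (k == 1).
  by have := m1 1 0 k l; rewrite c10 m2.
exists (GLval g 0 0); apply: scalar_mx22.
- by have := q10 0 0; rewrite /= mulr1n.
- by have := q01 1 1; rewrite /= mulr1n.
- by have := q01 0 1; rewrite /= !mulr1n.
Qed.

Lemma PSL2_P1_isog : (SL2 / 'Z(SL2) \isog PSL2_P1)%g.
Proof. by rewrite -ker_actperm_P1; apply: first_isog_loc; apply: finset.subsetT. Qed.

Lemma card_P1_gt1 : (1 < #|P1|)%N.
Proof.
have nz (i : 'I_2) : (delta_mx 0 i : 'rV[F]_2) != 0.
  by apply/eqP => /matrixP/(_ 0 i)/eqP; rewrite !mxE !eqxx oner_eq0.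
have Le i : is_line [set c *: (delta_mx 0 i : 'rV[F]_2) | c : F].
  by apply/existsP; exists (delta_mx 0 i); rewrite nz eqxx.
apply/card_gt1P; exists (exist is_line _ (Le 0)), (exist is_line _ (Le 1)).
split=> //; apply/eqP => /(congr1 val)/= /setP/(_ (delta_mx 0 0)).
have -> : delta_mx 0 0 \in [set c *: (delta_mx 0 0 : 'rV[F]_2) | c : F].
  by apply/imsetP; exists 1; rewrite ?scale1r.
move=> /esym/imsetP[c _ /matrixP/(_ 0 0)/eqP].
by rewrite !mxE /= mulr0 oner_eq0.
Qed.

Lemma PSL2_P1_transitive : [transitive PSL2_P1, on [set: P1] | 'P].
Proof.
have Le : is_line [set c *: (delta_mx 0 0 : 'rV[F]_2) | c : F].
  apply/existsP; exists (delta_mx 0 0); rewrite eqxx andbT.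
  by apply/eqP => /matrixP/(_ 0 0)/eqP; rewrite !mxE !eqxx oner_eq0.
apply/imsetP; exists (exist is_line _ Le : P1); rewrite ?inE //.
apply/setP=> L; rewrite inE; apply/esym/orbitP.
have /existsP[v /andP[v0 /eqP Lv]] := valP L.
pose w : 'rV[F]_2 := if v 0 0 == 0 then - (v 0 1)^-1 *: delta_mx 0 0
                     else (v 0 0)^-1 *: delta_mx 0 1.
pose M : 'M[F]_2 := \matrix_i (if i == 0 then v else w).
have dM : \det M = 1.
  rewrite det_mx22 !mxE /= /w; case: eqP => [v00|/eqP v00]; rewrite !mxE /=.
    rewrite v00 mul0r sub0r mulr1 mulrN opprK divff //.
    apply: contra v0 => /eqP v01; apply/eqP/matrixP=> i j; rewrite ord1 mxE.
    have [-> //|-> //] : j = 0 \/ j = 1.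
    by case: j => [[|[|j]] jl] //; [left|right]; apply: val_inj.
  by rewrite mulr1 mulr0 mulr0 subr0 divff.
have [g gS gM] := SL2_mem_ex dM.
exists (actperm P1_act g); first exact: mem_morphim.
rewrite /= apermE actpermE; apply: val_inj; rewrite /= Lv gM.
have eM : delta_mx 0 0 *m M = v by rewrite -rowE rowK.
apply/setP=> u; apply/imsetP/imsetP => [[_ /imsetP[c _ ->] ->]|[c _ ->]].
  by exists c => //; rewrite -scalemxAl eM.
by exists (c *: delta_mx 0 0); [exact: imset_f | rewrite -scalemxAl eM].
Qed.

End ProjectiveLine.

Section ProductAction.
Local Open Scope group_scope.
Variables Omega Delta : finType.
Implicit Types (a : {ffun Delta -> {perm Omega}}) (b : {perm Delta}).

(* The element (a, b) of the wreath product maps phi to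
   d |-> a_d (phi (b^-1 d)); permutations compose from left to right. *)
Definition pa_fun a b (phi : {ffun Delta -> Omega}) : {ffun Delta -> Omega} :=
  [ffun d => a d (phi (b^-1 d))].

Lemma pa_fun_inj a b : injective (pa_fun a b).
Proof.
move=> phi psi /ffunP eq_ab; apply/ffunP=> d.
by have := eq_ab (b d); rewrite !ffunE permK => /perm_inj.
Qed.

Definition pa_perm a b : {perm {ffun Delta -> Omega}} := perm (@pa_fun_inj a b).

Lemma pa_permE a b phi d : pa_perm a b phi d = a d (phi (b^-1 d)).
Proof. by rewrite permE ffunE. Qed.

Lemma pa_permM a a' b b' :
  pa_perm a b * pa_perm a' b' =
  pa_perm [ffun d => a (b'^-1 d) * a' d] (b * b').
Proof.
apply/permP=> phi; apply/ffunP=> d.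
by rewrite permM !pa_permE ffunE permM invMg permM.
Qed.

Lemma pa_perm1 : pa_perm [ffun=> 1] 1 = 1.
Proof.
by apply/permP=> phi; apply/ffunP=> d; rewrite pa_permE ffunE invg1 !perm1.
Qed.

Lemma pa_permV a b :
  (pa_perm a b)^-1 = pa_perm [ffun d => (a (b d))^-1] b^-1.
Proof.
apply: (mulgI (pa_perm a b)); rewrite mulgV pa_permM mulgV -pa_perm1.
by congr pa_perm; apply/ffunP=> d; rewrite !ffunE invgK mulgV.
Qed.

Lemma pa_perm_inj a a' b b' : (1 < #|Omega|)%N ->
  pa_perm a b = pa_perm a' b' -> a = a' /\ b = b'.
Proof.
move=> /card_gt1P[u1 [u2 [_ _ u12]]] eqab.
have aE : a = a'.
  apply/ffunP=> d; apply/permP=> w.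
  have := congr1 (fun s : {perm _} => s [ffun=> w] d) eqab.
  by rewrite !pa_permE !ffunE.
split=> //; apply: invg_inj; apply/permP=> d.
have := congr1
  (fun s : {perm _} => s [ffun e => if e == b^-1 d then u1 else u2] d) eqab.
rewrite !pa_permE !ffunE eqxx aE => /perm_inj.
by case: eqP => // _ oo; rewrite oo eqxx in u12.
Qed.

Definition pa_base (A : {set {perm Omega}}) : {set {ffun Delta -> {perm Omega}}} :=
  [set a : {ffun Delta -> {perm Omega}} | [forall d, a d \in A]].

Definition pa_wreath (A : {set {perm Omega}}) (B : {set {perm Delta}}) :
  {set {perm {ffun Delta -> Omega}}} :=
  [set pa_perm a b | a in pa_base A, b in B].

(* The graph of the natural projection (a, b) |-> b from the wreath product,
   whose kernel is the base group. The projection is a function as soon as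
   Omega has at least two points (pa_proj_unique), which holds for P^1(F). *)
Definition pa_proj (A : {set {perm Omega}}) (w : {perm {ffun Delta -> Omega}})
  (b : {perm Delta}) : bool := [exists a in pa_base A, w == pa_perm a b].

Variables (A : {group {perm Omega}}) (B : {group {perm Delta}}).

Lemma pa_wreath_group_set : group_set (pa_wreath A B).
Proof.
apply/group_setP; split=> [|_ _ /imset2P[a b + bB ->] /imset2P[a' b' + bB' ->]].
  apply/imset2P; exists [ffun=> 1] 1; rewrite ?group1 ?pa_perm1 //.
  by rewrite inE; apply/forallP=> d; rewrite ffunE group1.
rewrite !inE => /forallP aA /forallP aA'; rewrite pa_permM.
apply: imset2_f; last exact: groupM.
by rewrite inE; apply/forallP=> d; rewrite ffunE groupM.
Qed.
Canonical pa_wreath_group := Group pa_wreath_group_set.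

Lemma pa_proj1 : pa_proj A 1 1.
Proof.
apply/exists_inP; exists [ffun=> 1]; last by rewrite pa_perm1.
by rewrite inE; apply/forallP=> d; rewrite ffunE group1.
Qed.

Lemma pa_projM w w' b b' :
  pa_proj A w b -> pa_proj A w' b' -> pa_proj A (w * w') (b * b').
Proof.
move=> /exists_inP[a + /eqP ->] /exists_inP[a' + /eqP ->].
rewrite !inE => /forallP aA /forallP aA'; rewrite pa_permM.
apply/exists_inP; eexists; last exact: eqxx.
by rewrite inE; apply/forallP=> d; rewrite ffunE groupM.
Qed.

Lemma pa_projV w b : pa_proj A w b -> pa_proj A w^-1 b^-1.
Proof.
move=> /exists_inP[a + /eqP ->]; rewrite inE => /forallP aA; rewrite pa_permV.
apply/exists_inP; eexists; last exact: eqxx.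
by rewrite inE; apply/forallP=> d; rewrite ffunE groupV.
Qed.

Lemma pa_proj_unique w b b' : (1 < #|Omega|)%N ->
  pa_proj A w b -> pa_proj A w b' -> b = b'.
Proof.
move=> cO /exists_inP[a _ /eqP ->] /exists_inP[a' _ /eqP].
by case/(pa_perm_inj cO).
Qed.

End ProductAction.

Section IteratedWreath.
Variables (Omega : nat -> finType) (S : forall k, {group {perm Omega k}}).

(* The sequences are indexed from 0: Omega k and S k are the (k+1)-st set and
   group. Level 0 is the trivial group on one point, so level 1 is S 0 acting on
   the set of functions from a one-point set to Omega 0. *)
Fixpoint hatOmega (n : nat) : finType :=
  if n is m.+1 then {ffun hatOmega m -> Omega m} else unit.

Fixpoint Wpa_level (n : nat) : {group {perm hatOmega n}} :=
  match n return {group {perm hatOmega n}} with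
  | 0 => 1%G
  | m.+1 => pa_wreath_group (S m) (Wpa_level m)
  end.

End IteratedWreath.

Local Open Scope classical_set_scope.
Local Open Scope group_scope.

HB.mixin Record isProfiniteGroup G of monoid.Group G & Topological G := {
  mulg_continuous : continuous (fun xy : G * G => xy.1 * xy.2);
  invg_continuous : continuous (fun x : G => x^-1);
  profinite_compact : compact [set: G];
  profinite_hausdorff : hausdorff_space G;
  profinite_totally_disconnected : totally_disconnected [set: G] }.

#[short(type="profiniteGroupType")]
HB.structure Definition ProfiniteGroup :=
  { G of monoid.Group G & Topological G & isProfiniteGroup G }.

Section InverseLimit.
Local Open Scope classical_set_scope.
Variables (Omega : nat -> finType) (S : forall k, {group {perm Omega k}}).

Definition Wpa_prod : Type :=
  prod_topology (fun n => discrete_topology {perm hatOmega Omega n}).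
HB.instance Definition _ := Topological.on Wpa_prod.

(* Compatible sequences, inside the product of the discrete groups
   Sym(hatOmega n) with the product topology. *)
Definition Wpa_set : set Wpa_prod :=
  [set x | forall n, x n \in Wpa_level S n /\ pa_proj (S n) (x n.+1) (x n)].

Definition Wpa : Type := set_type Wpa_set.
HB.instance Definition _ := Topological.on Wpa.

Lemma Wpa_one_subproof : (fun n => 1%g : {perm hatOmega Omega n}) \in Wpa_set.
Proof. by apply/mem_set => n; split; [exact: group1 | exact: pa_proj1]. Qed.

Lemma Wpa_mul_subproof (x y : Wpa) :
  (fun n => (\val x n * \val y n)%g : {perm hatOmega Omega n}) \in Wpa_set.
Proof.
apply/mem_set => n; have [xn xp] := set_mem (valP x) n.
have [yn yp] := set_mem (valP y) n.
by split; [exact: groupM | exact: pa_projM].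
Qed.

Lemma Wpa_inv_subproof (x : Wpa) :
  (fun n => ((\val x n)^-1)%g : {perm hatOmega Omega n}) \in Wpa_set.
Proof.
apply/mem_set => n; have [xn xp] := set_mem (valP x) n.
by split; [rewrite groupV | exact: pa_projV].
Qed.

Definition Wpa_one : Wpa := exist (fun x => x \in Wpa_set) _ Wpa_one_subproof.
Definition Wpa_mul (x y : Wpa) : Wpa := exist (fun x => x \in Wpa_set) _ (Wpa_mul_subproof x y).
Definition Wpa_inv (x : Wpa) : Wpa := exist (fun x => x \in Wpa_set) _ (Wpa_inv_subproof x).

Lemma Wpa_eq (x y : Wpa) : (forall n, \val x n = \val y n) -> x = y.
Proof. by move=> xy; apply: val_inj; apply: functional_extensionality_dep. Qed.

Lemma Wpa_mulA : associative Wpa_mul.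
Proof. by move=> x y z; apply: Wpa_eq => n; apply: mulgA. Qed.
Lemma Wpa_mul1 : left_id Wpa_one Wpa_mul.
Proof. by move=> x; apply: Wpa_eq => n; apply: mul1g. Qed.
Lemma Wpa_1mul : right_id Wpa_one Wpa_mul.
Proof. by move=> x; apply: Wpa_eq => n; apply: mulg1. Qed.
Lemma Wpa_mulV : left_inverse Wpa_one Wpa_inv Wpa_mul.
Proof. by move=> x; apply: Wpa_eq => n; apply: mulVg. Qed.
Lemma Wpa_Vmul : right_inverse Wpa_one Wpa_inv Wpa_mul.
Proof. by move=> x; apply: Wpa_eq => n; apply: mulgV. Qed.

HB.instance Definition _ :=
  isGroup.Build Wpa Wpa_mulA Wpa_mul1 Wpa_1mul Wpa_mulV Wpa_Vmul.

Definition Wpa_coord n (x : Wpa) : discrete_topology {perm hatOmega Omega n} :=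
  \val x n.

Lemma Wpa_coord_continuous n : continuous (Wpa_coord n).
Proof.
move=> x; apply: (@continuous_comp Wpa Wpa_prod _ set_val (fun y => y n)).
  exact: initial_continuous.
exact: (@proj_continuous nat (fun n => discrete_topology {perm hatOmega Omega n})).
Qed.

Lemma Wpa_coord_open n (A : set {perm hatOmega Omega n}) : open (Wpa_coord n @^-1` A).
Proof. by apply: open_comp; [move=> ? _; exact: Wpa_coord_continuous | exact: discrete_open]. Qed.


Lemma Wpa_cvg (F : set_system Wpa) (x : Wpa) : Filter F ->
  (forall n, F (Wpa_coord n @^-1` [set Wpa_coord n x])) -> F --> x.
Proof.
move=> FF Fx U /= [_ [[V oV <-] Vx] sVU]; apply: filterS sVU _.
suff : (set_val @ F) --> (set_val x : Wpa_prod).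
  by apply; exact: open_nbhs_nbhs.
have surj n : (fun y : Wpa_prod => y n) @` setT = setT.
  apply/seteqP; split => // z _; exists (dfwith (\val x) n z) => //.
  by rewrite dfwithin.
apply/cvg_sup => n; apply/cvg_image; first exact: surj.
move=> A /=.
rewrite nbhs_principalE => /principal_filterP Ax.
exists ((fun y : Wpa_prod => y n) @^-1` A).
  suff : F (Wpa_coord n @^-1` A) by [].
  by apply: filterS (Fx n) => y /= ->.
exact: image_preimage.
Qed.

Lemma Wpa_mul_continuous : continuous (fun xy : Wpa * Wpa => (xy.1 * xy.2)%g).
Proof.
move=> [x y] /=; apply: Wpa_cvg => n.
exists (Wpa_coord n @^-1` [set Wpa_coord n x], Wpa_coord n @^-1` [set Wpa_coord n y]).
  by split; apply: open_nbhs_nbhs; split => //; exact: Wpa_coord_open.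
by move=> [u v] /= [ux vy]; rewrite /Wpa_coord /= -!/(Wpa_coord n _) ux vy.
Qed.

Lemma Wpa_inv_continuous : continuous (fun x : Wpa => (x^-1)%g : Wpa).
Proof.
have FF (y : Wpa) : Filter (nbhs y) by exact: nbhs_filter.
move=> x; apply: (@Wpa_cvg (fmap (fun y : Wpa => (y^-1)%g : Wpa) (nbhs x))) => n.
have Ux : nbhs (x : Wpa) (Wpa_coord n @^-1` [set Wpa_coord n x]).
  by apply: open_nbhs_nbhs; split => //; exact: Wpa_coord_open.
apply: (@filterS _ _ (FF x) _ _ _ Ux) => u /= ux.
by rewrite /Wpa_coord /=; congr (_^-1)%g.
Qed.

Lemma Wpa_zero_dimensional : zero_dimensional Wpa.
Proof.
move=> x y xy.
have [n xyn] : exists n, Wpa_coord n x <> Wpa_coord n y.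
  apply: contrapT => /forallNP h; move/eqP: xy; apply.
  by apply: Wpa_eq => n; exact: (contrapT (h n)).
exists (Wpa_coord n @^-1` [set Wpa_coord n x]); split => //; last by move=> /esym.
split; first exact: Wpa_coord_open.
by rewrite -[X in closed X]setCK closedC; exact: (Wpa_coord_open (~` [set Wpa_coord n x])).
Qed.

Lemma Wpa_hausdorff : hausdorff_space Wpa.
Proof.
move=> x y xy; apply/eqP; apply: contrapT => /negP.
case/Wpa_zero_dimensional => U [[oU cU] Ux Uy].
have [] := xy U (~` U); last by move=> z [].
  exact: open_nbhs_nbhs.
by apply: open_nbhs_nbhs; split => //; rewrite openC.
Qed.

Lemma Wpa_compact : compact [set: Wpa].
Proof.
rewrite compact_ultra => F FU _.
have Fa n : exists z, F (Wpa_coord n @^-1` [set z]).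
  apply: contrapT => /forallNP noz.
  have Fz (z : {perm hatOmega Omega n}) : F (Wpa_coord n @^-1` (~` [set z])).
    by case: (in_ultra_setVsetC (Wpa_coord n @^-1` [set z]) FU) => // /noz.
  have /filter_ex[x /(_ (Wpa_coord n x))] :
    F [set x | forall z : {perm hatOmega Omega n}, Wpa_coord n x <> z].
    exact: filter_forall.
  exact.
pose a n := xget (1%g : {perm hatOmega Omega n}) [set z | F (Wpa_coord n @^-1` [set z])].
have aF n : F (Wpa_coord n @^-1` [set a n]) by exact: (xgetPex _ (Fa n)).
have aW : (a : Wpa_prod) \in Wpa_set.
  apply/mem_set => n.
  have FI : F ((Wpa_coord n @^-1` [set a n]) `&` (Wpa_coord n.+1 @^-1` [set a n.+1])).
    exact: filterI.
  have [x [/= xn xn1]] := filter_ex FI.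
  by have := set_mem (valP x) n; rewrite -[\val x n]/(Wpa_coord n x)
    -[\val x n.+1]/(Wpa_coord n.+1 x) xn xn1.
exists (exist (fun x => x \in Wpa_set) _ aW); split => //.
exact: Wpa_cvg.
Qed.

HB.instance Definition _ := isProfiniteGroup.Build Wpa Wpa_mul_continuous
  Wpa_inv_continuous Wpa_compact Wpa_hausdorff
  (zero_dimension_totally_disconnected Wpa_zero_dimensional).

End InverseLimit.

Section SubgroupGrowth.
Local Open Scope classical_set_scope.
Local Open Scope group_scope.

Definition is_subgroup (G : groupType) (H : set G) : Prop :=
  [/\ H 1, forall x y, H x -> H y -> H (x * y) & forall x, H x -> H x^-1].

Definition left_cosets (G : groupType) (H : set G) : set (set G) :=
  [set [set x * h | h in H] | x in [set: G]].

Definition topologically_fg (G : profiniteGroupType) : Prop :=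
  exists2 A : set G, finite_set A & closure (smallest (@is_subgroup G) A) = setT.

Definition open_subgroups (G : profiniteGroupType) (n : nat) : set (set G) :=
  [set H | [/\ is_subgroup H, open H & (left_cosets H #<= `I_n)%card]].
Arguments open_subgroups : clear implicits.

(* fset_set sends infinite sets to the empty set, but a topologically finitely
   generated group has only finitely many open subgroups of index at most n. *)
Definition subgroup_count (G : profiniteGroupType) (n : nat) : nat :=
  #|` fset_set (open_subgroups G n)|%fset.

Local Open Scope ring_scope.

(* Subgroup growth type is a property of finitely generated profinite groups,
   so finite generation is part of it. *)
Definition has_subgroup_growth_type (R : realType) (G : profiniteGroupType)
    (g : nat -> R) : Prop :=
  topologically_fg G /\
  exists b c : R, [/\ 0 < b, 0 < c,
    \forall n \near \oo, (subgroup_count G n)%:R <= g n `^ b &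
    infinite_set [set n : nat | g n `^ c <= (subgroup_count G n)%:R]].

(* Functions on {1, 2, ...}: the value at 0 is irrelevant. For x >= 1 one has
   x^(log x) >= 1, so that truncn is the floor. *)
Definition gently_growing (R : realType) (f : nat -> R) : Prop :=
  [/\ forall M : R, exists2 n : nat, (0 < n)%N & M < `|f n|,
      forall m n : nat, (0 < m)%N -> (m <= n)%N -> f m <= f n,
      forall n : nat, (0 < n)%N -> 0 < f n &
      exists A N : R, [/\ 0 < A, 0 < N &
        forall x : nat, (0 < x)%N -> N <= x%:R ->
          f (Num.truncn (x%:R `^ ln (x%:R : R))) <= A * f x]].

End SubgroupGrowth.

(* Main.v *)
(* Write S_k = PSL_2(p_k), m_k for the number of points moved by the k-th level
   W_k, so that W_(k+1) = S_k wr W_k has m_k base coordinates.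

   Growth. The group S_k is generated by two elements of order p_k, so a subgroup
   of index n < p_k contains the whole base group S_k^(m_k); hence for
   p_k <= n < p_(k+1) the open subgroups of index at most n are those of W_(k+1).
   Every subgroup of SL_2(p) is boundedly generated (Sylow counting if p divides
   its order, the class equation over maximal tori otherwise), and a subgroup of an
   extension is determined by its intersection with the kernel, its image and lifts
   of generators of the image. Peeling off one coordinate at a time bounds the
   number of subgroups of index at most n by n^(34 m_k). Conversely the elementary
   abelian subgroup C_p^(m_k) of the base group has at least p_k^(m_k^2/8) subgroups,
   all of index at most |W_(k+1)| <= p_k^(5 m_k). So the growth type is n^(f n) as
   soon as f(p_k) and f(p_k^(5 m_k)) are both comparable to m_k; gentle growth makes
   f(2^t) at most linear in t and insensitive to t |-> t^2/2, so such a prime exists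
   between 2^t and 2^(2t+1) for a suitable t >= 60 m_k.

   Finite generation. Two generators of W_k with fixed points, of order prime to
   p_k, lift to W_(k+1) by putting a unipotent generator of S_k at the fixed
   coordinate: the two factors commute and have coprime orders, so both lie in the
   subgroup generated by the lifts, which is everything; and a constant function at
   a point fixed by the unipotent element is again a fixed point. *)
Require Import Defs.
From mathcomp Require Import all_boot all_order all_algebra all_fingroup.
From mathcomp Require Import all_solvable all_field zify ring.

Set Implicit Arguments.
Unset Strict Implicit.
Unset Printing Implicit Defensive.

(** * Generation and counting of subgroups *)

Section Generation.
Local Open Scope group_scope.

Definition generated_by (gT : finGroupType) (n : nat) (G : {set gT}) : Prop :=
  exists2 s : seq gT, size s <= n & <<[set x in s]>> = G.

Lemma generated_byW (gT : finGroupType) m n (G : {set gT}) :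
  m <= n -> generated_by m G -> generated_by n G.
Proof. by move=> mn [s sm sG]; exists s => //; apply: leq_trans mn. Qed.

Lemma generated_by_join (gT : finGroupType) m n (G H : {set gT}) :
  generated_by m G -> generated_by n H -> generated_by (m + n) (G <*> H).
Proof.
move=> [s sm <-] [t tn <-]; exists (s ++ t); first by rewrite size_cat leq_add.
rewrite joing_idl joing_idr; congr <<_>>.
by apply/setP=> x; rewrite !inE mem_cat.
Qed.

Lemma generated_by_cyclic (gT : finGroupType) (G : {set gT}) :
  cyclic G -> generated_by 1 G.
Proof.
move=> /cyclicP[x ->]; exists [:: x] => //.
by congr <<_>>; apply/setP=> y; rewrite !inE.
Qed.

(** Each element adjoined from outside the current subgroup at least halves the remaining index, so
    [c] of them suffice. *)
Lemma generated_by_index (gT : finGroupType) a c (M L : {group gT}) :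
  M \subset L -> #|L : M| <= 2 ^ c -> generated_by a M -> generated_by (a + c) L.
Proof.
elim: c a M => [|c IHc] a M sML iLM gM.
  have -> : L :=: M; last by rewrite addn0.
  apply/eqP; rewrite eqEsubset sML andbT -indexg_eq1 eqn_leq iLM.
  by rewrite indexg_gt0.
have [sLM|/subsetPn[x xL xM]] := boolP (L \subset M).
  have -> : L :=: M by apply/eqP; rewrite eqEsubset sML sLM.
  by apply: generated_byW gM; apply: leq_addr.
have gx : generated_by 1 <[x]> by apply: generated_by_cyclic; apply: cycle_cyclic.
have sM'L : M <*> <[x]> \subset L by rewrite join_subG sML cycle_subG.
rewrite addnS -addSn -(addn1 a).
apply: (IHc _ _ sM'L _ (generated_by_join gM gx)).
have sMM' : M \subset M <*> <[x]> by apply: joing_subl.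
have := Lagrange_index sM'L sMM'.
have i2 : 1 < #|M <*> <[x]> : M|.
  rewrite indexg_gt1; apply: contra xM => /subsetP; apply.
  by rewrite mem_gen // inE cycle_id orbT.
move=> e; move: iLM; rewrite -e expnS => h.
rewrite -(leq_pmul2l (isT : 0 < 2)) mulnC; apply: leq_trans h.
by rewrite leq_mul2l i2 orbT.
Qed.

Lemma generated_by_log (gT : finGroupType) c (L : {group gT}) :
  #|L| <= 2 ^ c -> generated_by c L.
Proof.
move=> cL; apply: (@generated_by_index _ 0 c 1%G); rewrite ?sub1G ?indexg1 //.
exists [::] => //; rewrite -[RHS]genGid; apply/eqP.
by rewrite eqEsubset !gen_subG sub1G andbT; apply/subsetP=> x; rewrite inE.
Qed.

Lemma generated_by_morphim (gT rT : finGroupType) (D : {group gT})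
    (f : {morphism D >-> rT}) n (G : {set gT}) :
  G \subset D -> generated_by n G -> generated_by n (f @* G).
Proof.
move=> sGD [s sn defG]; exists [seq f x | x <- s]; first by rewrite size_map.
have sD : [set x in s] \subset D by rewrite (subset_trans _ sGD) // -defG subset_gen.
rewrite -defG morphim_gen //; congr <<_>>; apply/setP=> y; rewrite inE.
apply/mapP/morphimP => [[x xs ->]|[x _]].
  by exists x; rewrite ?inE //; apply: (subsetP sD); rewrite inE.
by rewrite inE => xs ->; exists x.
Qed.

(** Generators of the kernel together with lifts of generators of the image: an element of [G]
    differs from a product of lifts by an element of the kernel. *)
Lemma generated_by_extension (gT rT : finGroupType) (D : {group gT})
    (f : {morphism D >-> rT}) a b (G : {group gT}) :
  G \subset D -> generated_by a ('ker_G f) -> generated_by b (f @* G) ->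
  generated_by (a + b) G.
Proof.
move=> sGD gK [s sb defI].
have pre y : y \in s -> exists2 x, x \in G & f x = y.
  move=> ys; have : y \in f @* G by rewrite -defI mem_gen ?inE.
  by case/morphimP=> x _ xG ->; exists x.
have [t [st tG ft]] : exists t : seq gT,
    [/\ size t = size s, {subset t <= G} & map f t = s].
  elim: (s) pre => [|y r IHr] pre; first by exists [::].
  have [|t [st tG ft]] := IHr; first by move=> z zr; apply: pre; rewrite inE zr orbT.
  have [x xG fx] := pre y (mem_head _ _).
  exists (x :: t); split; rewrite /= ?st ?fx ?ft //.
  by move=> z; rewrite inE => /predU1P[->|/tG].
have gt : generated_by b <<[set x in t]>> by exists t; rewrite ?st.
have sTG : [set x in t] \subset G by apply/subsetP=> x; rewrite inE => /tG.
suff <- : 'ker_G f <*> <<[set x in t]>> = G by apply: generated_by_join.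
apply/eqP; rewrite eqEsubset join_subG subsetIl gen_subG sTG /=.
apply/subsetP=> x xG.
have : f x \in f @* <<[set x in t]>>.
  rewrite morphim_gen ?(subset_trans sTG) //.
  suff -> : f @* [set x in t] = [set y in s] by rewrite defI mem_morphim ?(subsetP sGD).
  apply/setP=> y; rewrite inE -ft; apply/morphimP/mapP => [[z _ zt ->]|[z zt ->]].
    by exists z; rewrite inE in zt.
  by exists z; rewrite ?inE //; apply: (subsetP sGD); apply: tG.
case/morphimP=> z zD zT fxz; rewrite -(mulgKV z x); apply: groupM; last first.
  by rewrite mem_gen // inE zT orbT.
have zG : z \in G by apply: (subsetP _ _ zT); rewrite gen_subG.
rewrite mem_gen // inE; apply/orP; left; rewrite inE groupM ?groupV //=.
apply/kerP; first by rewrite groupM ?groupV ?(subsetP sGD).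
by rewrite morphM ?groupV ?(subsetP sGD) // morphV ?(subsetP sGD) // fxz mulgV.
Qed.

End Generation.

(** * Counting subgroups through tuples of generators and extensions *)

Section SubgroupCounting.
Local Open Scope group_scope.

Definition subgroups_index_le (gT : finGroupType) (n : nat) (G : {set gT}) :
  {set {group gT}} := [set H : {group gT} | (H \subset G) && (#|G : H| <= n)].

Lemma card_subgroups_le (gT : finGroupType) n s (G : {group gT}) :
  (forall L : {group gT}, L \subset G -> generated_by s L) ->
  #|subgroups_index_le n G| <= #|G| ^ s.
Proof.
move=> gG; pose T := [set t : {ffun 'I_s -> gT} | t \in ffun_on (mem G)].
have cT : #|T| = (#|G| ^ s)%N.
  by rewrite cardsE card_ffun_on card_ord.
rewrite -cT; pose F (t : {ffun 'I_s -> gT}) := <<[set t i | i : 'I_s]>>%G.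
apply: leq_trans (leq_imset_card F T); apply: subset_leq_card.
apply/subsetP=> H; rewrite inE => /andP[sHG _].
have [r rs defH] := gG H sHG.
have rH x : x \in r -> x \in H by move=> xr; rewrite -defH mem_gen ?inE.
(* Generating lists shorter than [s] are padded with 1. *)
apply/imsetP; exists [ffun i : 'I_s => nth 1 r i].
  rewrite inE; apply/ffun_onP=> i; rewrite ffunE /=.
  have [ir|ir] := ltnP i (size r); last by rewrite nth_default ?group1.
  by apply: (subsetP sHG); apply: rH; apply: mem_nth.
apply: val_inj; rewrite /= -[LHS]defH; apply/eqP; rewrite eqEsubset !gen_subG.
apply/andP; split; apply/subsetP=> x.
  rewrite inE => xr; have ir : index x r < s by rewrite (leq_trans _ rs) // index_mem.
  rewrite mem_gen //; apply/imsetP; exists (Ordinal ir) => //.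
  by rewrite ffunE /= nth_index.
case/imsetP=> i _ ->; rewrite ffunE.
have [ir|ir] := ltnP i (size r); last by rewrite nth_default ?group1.
by rewrite mem_gen // inE mem_nth.
Qed.

(* A subgroup H is determined by its intersection K with the kernel, by its
   image, and by lifts of s generators of the image, which matter only modulo K. *)
Lemma card_subgroups_extension (gT rT : finGroupType) (D : {group gT})
    (f : {morphism D >-> rT}) n s (G : {group gT}) :
  G \subset D ->
  (forall L : {group rT}, L \subset f @* G -> generated_by s L) ->
  #|subgroups_index_le n G| <=
    #|subgroups_index_le n ('ker_G f)| * #|subgroups_index_le n (f @* G)| * n ^ s.
Proof.
move=> sGD gI; set N := 'ker_G f; set SG := subgroups_index_le n G.
pose P := setX (subgroups_index_le n N) (subgroups_index_le n (f @* G)).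
pose h (H : {group gT}) : {group gT} * {group rT} := ((N :&: H)%G, (f @* H)%G).
have hP H : H \in SG -> h H \in P.
  rewrite inE => /andP[sHG iH]; rewrite !inE subsetIl /= morphimS //=.
  rewrite indexgI; move: iH; rewrite -(index_morphim_ker f sHG sGD) => iH.
  apply/andP; split; apply: leq_trans iH.
    by rewrite leq_pmull ?indexg_gt0.
  by rewrite leq_pmulr ?indexg_gt0.
(* Partition by the pair (K, L) of kernel part and image; it remains to bound each fibre by n^s. *)
rewrite -sum1_card (partition_big h (mem P)) //=.
rewrite -cardsX -/P -sum_nat_const; apply: leq_sum => -[K L] /setXP[/=].
rewrite !inE => /andP[sKN iK] /andP[sLI iL].
rewrite sum1dep_card.
have [r rs defL] := gI L sLI.
have lift (i : 'I_s) : exists2 x, x \in G & f x = nth 1 r i.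
  have : nth 1 r i \in f @* G.
    have [ir|ir] := ltnP i (size r); last by rewrite nth_default ?group1.
    by apply: (subsetP sLI); rewrite -defL mem_gen // inE mem_nth.
  by case/morphimP=> x _ xG ->; exists x.
have [t tG ft] := fin_all_exists2 lift.
(* A subgroup in the fibre is recovered from one coset of [K] in [N] for each fixed lift [t i];
   there are |N : K|^s <= n^s such families. *)
pose F (c : {ffun 'I_s -> {set gT}}) := <<K :|: \bigcup_i (t i *: c i)>>%G.
apply: leq_trans (_ : #|F @: [set c in ffun_on (mem (lcosets K N))]| <= _); last first.
  apply: leq_trans (leq_imset_card _ _) _.
  rewrite cardsE card_ffun_on card_ord card_lcosets.
  by case: (posnP s) => [->//|s0]; rewrite leq_exp2r.
apply: subset_leq_card; apply/subsetP=> H; rewrite !inE.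
case/andP=> /andP[sHG _] /eqP[/(congr1 val)/= defK /(congr1 val)/= defL'].
have sHD := subset_trans sHG sGD.
(* The lift [t i] need not lie in [H], but some element of its coset modulo [N] does. *)
have fix_t (i : 'I_s) : exists2 y, y \in N & t i * y \in H.
  have : nth 1 r i \in f @* H.
    rewrite defL'; have [ir|ir] := ltnP i (size r); last by rewrite nth_default ?group1.
    by rewrite -defL mem_gen // inE mem_nth.
  case/morphimP=> x xD xH fx; exists ((t i)^-1 * x); last by rewrite mulKVg.
  have tD := subsetP sGD _ (tG i).
  rewrite inE groupM ?groupV ?tG ?(subsetP sHG) //=.
  apply/kerP; first by rewrite groupM ?groupV.
  by rewrite morphM ?groupV // morphV // ft -fx mulVg.
have [y yN tyH] := fin_all_exists2 fix_t.
apply/imsetP; exists [ffun i => y i *: K].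
  by rewrite inE; apply/ffun_onP=> i; rewrite ffunE; apply/lcosetsP; exists (y i).
apply: val_inj => /=; apply/eqP; rewrite eqEsubset; apply/andP; split; last first.
  rewrite gen_subG subUset -defK subsetIr /=; apply/bigcupsP=> i _.
  rewrite ffunE -lcosetM; apply/subsetP=> z /lcosetP[k kK ->].
  by rewrite groupM ?tyH // -[k \in _]/(k \in (H : {set gT})); case/setIP: kK.
set E := << _ >>; have tyE i : t i * y i \in E.
  rewrite mem_gen // inE; apply/orP; right; apply/bigcupP; exists i => //.
  by rewrite ffunE -lcosetM lcoset_refl.
have tyD i : t i * y i \in D by apply: (subsetP sHD).
apply/subsetP=> x xH.
pose Y := [set t i * y i | i : 'I_s].
have sYD : Y \subset D by apply/subsetP=> _ /imsetP[i _ ->].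
have : f x \in f @* <<Y>>.
  rewrite morphim_gen //.
  have : f x \in f @* H by rewrite mem_morphim ?(subsetP sHD).
  rewrite defL' -[in f x \in _]defL; apply/subsetP/genS/subsetP=> z; rewrite inE => zr.
  have zs : index z r < s by rewrite (leq_trans _ rs) // index_mem.
  have yD i : y i \in D by have := yN i; rewrite inE => /andP[/(subsetP sGD)].
  apply/morphimP; exists (t (Ordinal zs) * y (Ordinal zs)) => //.
    by apply/imsetP; exists (Ordinal zs).
  have yk : y (Ordinal zs) \in 'ker f by have := yN (Ordinal zs); rewrite inE => /andP[].
  by rewrite morphM ?(subsetP sGD _ (tG _)) // (mker yk) mulg1 ft /= nth_index.
have sYE : <<Y>> \subset E by rewrite gen_subG; apply/subsetP=> _ /imsetP[i _ ->].
have sYH : <<Y>> \subset H by rewrite gen_subG; apply/subsetP=> _ /imsetP[i _ ->].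
case/morphimP=> z zD zY fxz; rewrite -(mulgKV z x).
apply: groupM; last exact: (subsetP sYE).
have xzH : x * z^-1 \in H by rewrite groupM // groupV (subsetP sYH).
rewrite mem_gen // inE -defK inE xzH andbT; apply/orP; left.
rewrite inE (subsetP sHG) //=; apply/kerP; first exact: (subsetP sHD).
by rewrite morphM ?groupV ?(subsetP sHD _ xH) // morphV // fxz mulgV.
Qed.

End SubgroupCounting.

(** * Subgroups of SL_2 over a prime field *)

Section ClassEquation.
Local Open Scope group_scope.

(** Encodes X = c o for some c >= 2, exactly for small c and by an inequality from 6 on, which keeps
    the case analysis linear. *)
Let small (X o : nat) :=
  (X = 2 * o \/ X = 3 * o \/ X = 4 * o \/ X = 5 * o \/ 6 * o <= X)%N.

Let small1 X o : small X o -> (2 * o <= X)%N.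
Proof. rewrite /small; lia. Qed.

(** With a = X/c1, b = X/c2, c = X/c3 this is the equation 1/c1 + 1/c2 + 1/c3 = 1 + 1/X known from
    finite rotation groups; its solutions (2,2,X), (2,3,3), (2,3,4), (2,3,5) all have a part of size
    at most 30. *)
Let three_classes X a b c : 30 < a -> 30 < b -> 30 < c -> (a + b + c = X.+1)%N ->
  small X a -> small X b -> small X c -> False.
Proof.
rewrite /small => ? ? ? ? [?|[?|[?|[?|?]]]] [?|[?|[?|[?|?]]]] [?|[?|[?|[?|?]]]]; lia.
Qed.

(** Each summand is at least g/4, since e <= 2 and c >= 2, so there are fewer than four classes. If
    g > 60 c for all of them, then every o exceeds 30, and one, two or three classes are excluded
    arithmetically. *)
Lemma class_equation_bound (I : finType) (P : {set I}) (e c o : I -> nat) g :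
  1 < g ->
  (forall i, i \in P -> [/\ 0 < e i <= 2, 1 < c i & e i * c i * o i = g]%N) ->
  (\sum_(i in P) o i * (c i).-1 = g.-1)%N ->
  exists2 i, i \in P & g <= 60 * c i.
Proof.
move=> g1 hP hS; have [/exists_inP[i iP gi]|] := boolP [exists i in P, g <= 60 * c i].
  by exists i.
rewrite negb_exists_in => /forall_inP big; exfalso.
(* Here X = c o, which is g or g/2 according to the value of e. *)
have fact i : i \in P -> exists X, [/\ (o i * (c i).-1 = X - o i)%N, 30 < o i,
    X = g \/ 2 * X = g & small X (o i)]%N.
  move=> iP; have [ei ci gi] := hP i iP; have bi := big i iP; exists (c i * o i)%N.
  split; first by case: (c i) ci => // k _; rewrite mulSn mulnC addnC addnK.
  - rewrite ltnNge; apply: contra bi => o30; rewrite -gi.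
    have /andP[_ e2] := ei.
    apply: leq_trans (leq_mul (leq_mul e2 (leqnn (c i))) o30) _; lia.
  -
    have [e1|e2] : e i = 1%N \/ e i = 2 by lia.
      by left; rewrite -gi e1 mul1n.
    by right; rewrite -gi e2 mulnA.
  -
  have [c2|[c3|[c4|[c5|c6]]]] : (c i = 2 \/ c i = 3 \/ c i = 4 \/ c i = 5 \/ 6 <= c i)%N by lia.
  - by rewrite c2; left.
  - by rewrite c3; right; left.
  - by rewrite c4; do 2!right; left.
  - by rewrite c5; do 3!right; left.
  - by do 4!right; rewrite leq_mul2r c6 orbT.
have lt4 : #|P| < 4.
  rewrite ltnNge; apply/negP=> P4.
  have : (#|P| * g <= 4 * g.-1)%N.
    rewrite -hS big_distrr /= -sum_nat_const; apply: leq_sum => i /hP[ei ci <-].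
    have /andP[_ e2] := ei; have c2 : c i <= 2 * (c i).-1 by lia.
    by apply: leq_trans (leq_mul (leq_mul e2 c2) (leqnn (o i))) _; lia.
  have : (4 * g <= #|P| * g)%N by rewrite leq_mul2r P4 orbT.
  lia.
rewrite cardE in lt4; have mP i : i \in enum P -> i \in P by rewrite mem_enum.
move: hS; rewrite -big_enum /=.
case: (enum P) lt4 mP => [|i1 [|i2 [|i3 [|//]]]] _ mP.
- by rewrite big_nil; lia.
- have [|X1 [r1 o1 h1 /small1 k1]] := fact i1; first by apply: mP; rewrite !inE eqxx ?orbT.
  by rewrite !big_cons big_nil r1; lia.
- have [|X1 [r1 o1 h1 k1]] := fact i1; first by apply: mP; rewrite !inE eqxx ?orbT.
  have [|X2 [r2 o2 h2 k2]] := fact i2; first by apply: mP; rewrite !inE eqxx ?orbT.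
  by rewrite !big_cons big_nil r1 r2; case: k1 => [?|[?|[?|[?|?]]]]; case: k2 => [?|[?|[?|[?|?]]]]; lia.
- have [|X1 [r1 o1 h1 k1]] := fact i1; first by apply: mP; rewrite !inE eqxx ?orbT.
  have [|X2 [r2 o2 h2 k2]] := fact i2; first by apply: mP; rewrite !inE eqxx ?orbT.
  have [|X3 [r3 o3 h3 k3]] := fact i3; first by apply: mP; rewrite !inE eqxx ?orbT.
  rewrite !big_cons big_nil r1 r2 r3 => S.
  have w1 := small1 k1; have w2 := small1 k2; have w3 := small1 k3.
  (* If some X were g, the three terms would already add up to at least g; so all are g/2 and the
     class sizes add up to X + 1. *)
  apply: (@three_classes X1 (o i1) (o i2) (o i3)) => //.
  - by clear k1 k2 k3; lia.
  - by have -> : X1 = X2 by clear k1 k2 k3; lia.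
  - by have -> : X1 = X3 by clear k1 k2 k3; lia.
Qed.

(* The class equation of Dickson's classification: the centralisers of the
   non-central elements cover L and meet pairwise in Z. *)
Lemma partition_by_centralisers (gT : finGroupType) (L Z : {group gT}) :
  Z \subset L -> L \subset 'C(Z) ->
  (forall x, x \in L :\: Z -> abelian 'C_L[x]) ->
  (forall x, x \in L :\: Z -> #|'N_L('C_L[x]) : 'C_L[x]| <= 2) ->
  L :=: Z \/ exists2 x, x \in L :\: Z & #|L| <= 60 * #|'C_L[x]|.
Proof.
move=> sZL cZL abC indC.
have [sLZ|nLZ] := boolP (L \subset Z); first by left; apply/eqP; rewrite eqEsubset sLZ.
right; pose T := L :\: Z; pose CC := [set 'C_L[x] | x in T].
have sZC x : x \in L -> Z \subset 'C_L[x].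
  by move=> xL; rewrite subsetI sZL sub_cent1 (subsetP cZL).
have xC x : x \in T -> x \in 'C_L[x].
  by move=> /setDP[xL _]; rewrite inE xL cent1id.
(* An abelian centraliser containing a non-central x lies in the centraliser of x; by symmetry the
   two agree. *)
have eqC x y : y \in T -> x \in 'C_L[y] :\: Z -> 'C_L[x] = 'C_L[y].
  move=> yT /setDP[xy xZ]; have xT : x \in T by rewrite inE xZ; case/setIP: xy.
  have yx : y \in 'C_L[x].
    by rewrite inE; case/setDP: yT => -> _; rewrite cent1C; case/setIP: xy.
  have sub a b : a \in T -> b \in 'C_L[a] -> 'C_L[a] \subset 'C_L[b].
    move=> aT ba; rewrite subsetI subsetIl sub_cent1.
    exact: (subsetP (abC a aT)).
  by apply/eqP; rewrite eqEsubset !sub.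
pose OO := [set C :^: L | C in CC].
(* A representative of each conjugacy class of centralisers; on [OO] the default [set0] does not
   occur. *)
pose cen (O : {set {set gT}}) := odflt set0 [pick C in CC | O == C :^: L].
have cenP O : O \in OO -> cen O \in CC /\ O = cen O :^: L.
  case/imsetP=> C CCC ->; rewrite /cen; case: pickP => [C' /andP[? /eqP]//|].
  by move/(_ C); rewrite CCC eqxx.
have cardO O C : O \in OO -> C \in O -> #|C| = #|cen O|.
  by case/cenP=> _ {1}->; case/imsetP=> g _ ->; rewrite cardJg.
pose z := #|Z|; pose g := #|L : Z|.
have gz : (z * g = #|L|)%N by rewrite Lagrange.
have z0 : 0 < z by apply: cardG_gt0.
have memCC x : x \in T -> 'C_L[x] \in CC by move=> xT; apply/imsetP; exists x.
have CCJ C h : C \in CC -> h \in L -> C :^ h \in CC.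
  case/imsetP=> x xT -> hL; apply/imsetP; exists (x ^ h).
    case/setDP: xT => xL xZ; apply/setDP; split; first exact: groupJ.
    rewrite memJ_norm //; apply: subsetP h hL.
    exact: subset_trans cZL (cent_sub _).
  by rewrite conjIg conjGid // cent1J.
(* Sort the non-central elements by their centraliser, and the centralisers by conjugacy class; each
   centraliser C accounts for |C| - |Z| elements. *)
have cardT : (\sum_(O in OO) #|O| * (#|cen O| - z) = #|L| - z)%N.
  have -> : (#|L| - z = #|T|)%N by rewrite cardsD (setIidPr sZL).
  rewrite -sum1_card (partition_big (fun x => 'C_L[x]) (mem CC)) //=.
  rewrite (partition_big (fun C => C :^: L) (mem OO)) /=; last first.
    by move=> C CCC; apply/imsetP; exists C.
  apply: eq_bigr => O OOO.
  have [cCC defO] := cenP O OOO.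
  rewrite -sum_nat_const; apply: eq_big => [C|C CO].
    apply/idP/andP => [CO|[CCC /eqP <-]]; last first.
      by apply/imsetP; exists 1; rewrite ?group1 ?conjsg1.
    move: (CO); rewrite defO => /imsetP[h hL ->]; split; first exact: CCJ.
    apply/eqP/setP=> B; apply/imsetP/imsetP => [[k kL ->]|[k kL ->]].
      by exists (h * k); rewrite ?groupM ?conjsgM.
    by exists (h^-1 * k); rewrite ?groupM ?groupV // -conjsgM mulKVg.
  rewrite -(cardO O C OOO CO) sum1dep_card.
  have [y yT defC] : exists2 y, y \in T & C = 'C_L[y].
    move: CO; rewrite defO => /imsetP[h hL ->].
    by case/imsetP: (CCJ _ _ cCC hL) => y; exists y.
  have yL : y \in L by case/setDP: yT.
  have -> : [set x in T | 'C_L[x] == C] = C :\: Z.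
    apply/setP=> x; rewrite defC; apply/setIdP/idP => [[xT /eqP <-]|xC'].
      by rewrite inE xC // andbT; case/setDP: xT.
    split; last by rewrite (eqC _ _ yT).
    by case/setDP: xC' => /setIP[xL _] xZ; rewrite inE xL xZ.
  by rewrite cardsD (setIidPr _) // defC sZC.
(* Division by |Z| gives the class equation, with e = |N_L(C) : C|, c = |C : Z| and o the number of
   conjugates of C. *)
have [|||O OOO gO] := @class_equation_bound _ OO
    (fun O => #|'N_L(cen O) : cen O|) (fun O => #|cen O| %/ z) (fun O => #|O|) g.
- by rewrite indexg_gt1.
- move=> O OOO; have [/imsetP[x xT defC] defO] := cenP O OOO.
  have xL : x \in L by case/setDP: xT.
  split.
  - by rewrite defC indC // indexg_gt0.
  - rewrite defC -(Lagrange (sZC x xL)) mulKn // indexg_gt1.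
    by apply/subsetPn; exists x; [apply: xC | case/setDP: xT].
  have nC : 'C_L[x] \subset 'N_L('C_L[x]) by rewrite subsetI subsetIl normG.
  have -> : #|O| = #|L : 'N_L('C_L[x])| by rewrite defO card_conjugates defC.
  rewrite defC -[in (_ %/ z)%N](Lagrange (sZC x xL)) mulKn //.
  apply/eqP; rewrite -(eqn_pmul2l z0) gz; apply/eqP.
  have := Lagrange (subsetIl L 'N('C_L[x])); have := Lagrange nC.
  have := Lagrange (sZC x xL); rewrite -/z => <- <- <-.
  by rewrite !mulnA; congr (_ * _)%N; rewrite -!mulnA; congr (_ * _)%N; rewrite mulnC.
- apply/eqP; rewrite -(eqn_pmul2l z0) big_distrr /= -subn1 mulnBr gz muln1 -cardT.
  apply/eqP; apply: eq_bigr => O OOO; have [/imsetP[x xT defC] _] := cenP O OOO.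
  have xL : x \in L by case/setDP: xT.
  rewrite defC -(Lagrange (sZC x xL)) -/z mulKn // -subn1.
  by move: #|_ : _| #|_| => a b; nia.
have [/imsetP[x xT defC] _] := cenP O OOO.
have xL : x \in L by case/setDP: xT.
exists x => //; rewrite -gz -(Lagrange (sZC x xL)) -/z; move: gO.
by rewrite defC -(Lagrange (sZC x xL)) mulKn // => gO; nia.
Qed.

End ClassEquation.

(** * Two by two matrices over a field *)

Section Matrices.
Import GRing.Theory.
Local Open Scope ring_scope.
Variable F : fieldType.
Implicit Types (M X Y N : 'M[F]_2) (v w : 'rV[F]_2).

Lemma ord2E (i : 'I_2) : i = 0 \/ i = 1.
Proof. by case: i => [[|[|i]] hi] //; [left|right]; apply: val_inj. Qed.

Lemma mx22P M N : M 0 0 = N 0 0 -> M 0 1 = N 0 1 -> M 1 0 = N 1 0 ->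
  M 1 1 = N 1 1 -> M = N.
Proof.
move=> h00 h01 h10 h11; apply/matrixP=> i j.
by case: (ord2E i) => ->; case: (ord2E j) => ->.
Qed.

Lemma rV2P v w : v 0 0 = w 0 0 -> v 0 1 = w 0 1 -> v = w.
Proof.
by move=> h0 h1; apply/matrixP=> i j; rewrite ord1; case: (ord2E j) => ->.
Qed.

Lemma mulmx22E n (M : 'M[F]_(n, 2)) N i j :
  (M *m N) i j = M i 0 * N 0 j + M i 1 * N 1 j.
Proof.
rewrite mxE !big_ord_recl big_ord0 addr0.
by congr (_ + M i _ * N _ j); apply: val_inj.
Qed.

Lemma det22 M : \det M = M 0 0 * M 1 1 - M 0 1 * M 1 0.
Proof.
rewrite (expand_det_row _ 0) !big_ord_recl big_ord0 /cofactor !det_mx11 !mxE /=.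
rewrite addr0 expr0 expr1 mul1r mulN1r mulrN.
by congr (_ * M _ _ - M _ _ * M _ _); apply: val_inj.
Qed.

Lemma trace22 M : \tr M = M 0 0 + M 1 1.
Proof.
rewrite /mxtrace !big_ord_recl big_ord0 addr0.
by congr (_ + M _ _); apply: val_inj.
Qed.

Lemma parallel_rV2 v w : v != 0 -> v 0 0 * w 0 1 = v 0 1 * w 0 0 ->
  exists c, w = c *: v.
Proof.
move=> v0 e; have [v00|v00] := eqVneq (v 0 0) 0.
  have v01 : v 0 1 != 0.
    by apply: contra v0 => /eqP v01; apply/eqP/rV2P; rewrite mxE.
  exists (w 0 1 / v 0 1); apply: rV2P; rewrite mxE ?divfK // v00 mulr0.
  by apply/eqP; move: e; rewrite v00 mul0r => /esym/eqP; rewrite mulf_eq0 (negbTE v01).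
exists (w 0 0 / v 0 0); apply: rV2P; rewrite mxE ?divfK //.
by rewrite mulrAC [w 0 0 * _]mulrC -e mulrAC mulfV ?mul1r.
Qed.

(** A nonzero [N] has a left kernel of dimension at most one: the determinant of the rows v, w
    annihilates every entry of [N], so it must vanish. *)
Lemma kernel_line N v w : N != 0 -> v != 0 -> v *m N = 0 -> w *m N = 0 ->
  exists c, w = c *: v.
Proof.
move=> N0 v0 vN wN; apply: parallel_rV2 => //; apply/eqP; rewrite -subr_eq0.
have eN (u : 'rV_2) j : u *m N = 0 -> u 0 0 * N 0 j + u 0 1 * N 1 j = 0.
  by move=> uN; rewrite -mulmx22E uN mxE.
apply: contraNT N0 => d0; apply/eqP.
have c1 j : (v 0 0 * w 0 1 - v 0 1 * w 0 0) * N 1 j = 0.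
  transitivity (v 0 0 * (w 0 0 * N 0 j + w 0 1 * N 1 j) -
                w 0 0 * (v 0 0 * N 0 j + v 0 1 * N 1 j)); first by ring.
  by rewrite !eN // !mulr0 subr0.
have c0 j : (v 0 0 * w 0 1 - v 0 1 * w 0 0) * N 0 j = 0.
  transitivity (w 0 1 * (v 0 0 * N 0 j + v 0 1 * N 1 j) -
                v 0 1 * (w 0 0 * N 0 j + w 0 1 * N 1 j)); first by ring.
  by rewrite !eN // !mulr0 subr0.
have nz x : (v 0 0 * w 0 1 - v 0 1 * w 0 0) * x = 0 -> x = 0.
  by move=> /eqP; rewrite mulf_eq0 (negbTE d0) => /eqP.
by apply: mx22P; rewrite [RHS]mxE; apply: nz.
Qed.

(** A non-scalar two by two matrix is cyclic, so its centraliser consists of the polynomials in it.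
    The cases ask which of X01, X10 and X00 - X11 is nonzero; that entry is the denominator of
    [b]. *)
Lemma commute_mx22 X Y : ~~ is_scalar_mx X -> X *m Y = Y *m X ->
  exists a b, Y = a%:M + b *: X.
Proof.
move=> nsX /matrixP com.
have := com 0 0; have := com 0 1; have := com 1 0; rewrite !mulmx22E => e10 e01 e00.
have [x01|x01] := eqVneq (X 0 1) 0; last first.
  exists (Y 0 0 - Y 0 1 / X 0 1 * X 0 0), (Y 0 1 / X 0 1).
  apply: mx22P; rewrite !mxE /= ?mulr1n ?mulr0n; first by ring.
  - by field.
  - apply: (mulfI x01); rewrite add0r mulrCA mulrA divfK //.
    have : X 0 1 * Y 1 0 = Y 0 1 * X 1 0 by move: e00; rewrite [Y 0 0 * _]mulrC => /addrI.
    by move=> ->.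
  - apply: (mulfI x01).
    transitivity (X 0 1 * Y 1 1 + X 0 0 * Y 0 1 - X 0 0 * Y 0 1); first by ring.
    by rewrite [X 0 1 * Y 1 1 + _]addrC e01; field.
have [x10|x10] := eqVneq (X 1 0) 0; last first.
  exists (Y 0 0 - Y 1 0 / X 1 0 * X 0 0), (Y 1 0 / X 1 0).
  move: e00 e01 e10; rewrite x01 !mul0r !mulr0 !addr0 => e00 e01 e10.
  have y01 : Y 0 1 = 0.
    apply: (mulIf x10); rewrite mul0r; apply: (addrI (Y 0 0 * X 0 0)).
    by rewrite addr0 -e00 mulrC.
  apply: mx22P; rewrite !mxE /= ?mulr1n ?mulr0n ?x01 ?y01 ?mulr0 ?addr0 //.
  - by ring.
  - by rewrite add0r divfK.
  - apply: (mulfI x10).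
    transitivity (Y 1 0 * X 0 0 + Y 1 1 * X 1 0 - Y 1 0 * X 0 0); first by ring.
    by rewrite -e10; field.
have x00 : X 0 0 - X 1 1 != 0.
  apply: contra nsX => /eqP/subr0_eq x00; apply/is_scalar_mxP; exists (X 0 0).
  by apply: mx22P; rewrite !mxE /= ?mulr1n ?mulr0n.
have y01 : Y 0 1 = 0.
  apply: (mulfI x00); move: e01; rewrite x01 mulr0 mul0r addr0 add0r => e.
  by rewrite mulr0 mulrBl e mulrC subrr.
have y10 : Y 1 0 = 0.
  apply: (mulfI x00); move: e10; rewrite x10 mulr0 mul0r addr0 add0r => e.
  by rewrite mulr0 mulrBl e mulrC subrr.
exists (Y 0 0 - (Y 0 0 - Y 1 1) / (X 0 0 - X 1 1) * X 0 0), ((Y 0 0 - Y 1 1) / (X 0 0 - X 1 1)).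
apply: mx22P; rewrite !mxE /= ?mulr1n ?mulr0n ?x01 ?x10 ?y01 ?y10 ?mulr0 ?addr0 //.
  by ring.
by field.
Qed.

Lemma commute_affine22 X a b c d :
  (a%:M + b *: X) *m (c%:M + d *: X) = (c%:M + d *: X) *m (a%:M + b *: X).
Proof.
by apply: mx22P; rewrite !mulmx22E !mxE /= ?mulr1n ?mulr0n; ring.
Qed.

Lemma cayley_hamilton22 M : M *m M = \tr M *: M - (\det M)%:M.
Proof.
rewrite trace22 det22; apply: mx22P; rewrite !mulmx22E !mxE /= ?mulr1n ?mulr0n; ring.
Qed.

Definition transvection_mx (i j : 'I_2) (t : F) : 'M[F]_2 := 1%:M + t *: delta_mx i j.

Lemma det_transvection i j t : i != j -> \det (transvection_mx i j t) = 1.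
Proof.
rewrite det22 /transvection_mx !mxE.
by case: (ord2E i) (ord2E j) => -> [] -> //= _; rewrite ?mulr1n ?mulr0n; ring.
Qed.

Lemma trace_transvection i j t : i != j -> \tr (transvection_mx i j t) = 2.
Proof.
rewrite trace22 /transvection_mx !mxE.
by case: (ord2E i) (ord2E j) => -> [] -> //= _; rewrite ?mulr1n ?mulr0n; ring.
Qed.

Lemma transvection_decomposition M : \det M = 1 -> M 1 0 != 0 ->
  M = transvection_mx 0 1 ((M 0 0 - 1) / M 1 0) *m transvection_mx 1 0 (M 1 0)
      *m transvection_mx 0 1 ((M 1 1 - 1) / M 1 0).
Proof.
move=> dM c0; have M01 : M 0 1 = (M 0 0 * M 1 1 - 1) / M 1 0.
  by rewrite -dM det22 opprB addrC subrK mulfK.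
by apply: mx22P; rewrite !mulmx22E /transvection_mx !mxE /= ?mulr1n ?mulr0n ?M01; field.
Qed.

Lemma transvection_mulmx10 M : (transvection_mx 1 0 1 *m M) 1 0 = M 0 0 + M 1 0.
Proof. by rewrite mulmx22E /transvection_mx !mxE /= mulr1n mulr0n; ring. Qed.

End Matrices.

(** * Order of SL_2, unipotent elements, stabilisers of lines and Sylow counts *)

Section SpecialLinear.
Import GRing.Theory.
Local Open Scope ring_scope.

Lemma det22_sub1 (F : fieldType) (M : 'M[F]_2) :
  \det (M - 1%:M) = \det M - \tr M + 1.
Proof. by rewrite !det22 trace22 !mxE /= ?mulr1n ?mulr0n; ring. Qed.

(** The determinant splits GL_2 into |F| - 1 cosets of SL_2, with representatives diag(c, 1). *)
Lemma card_SL2 (F : finFieldType) :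
  #|SL2 F| = (#|F| * #|F|.-1 * #|F|.+1)%N.
Proof.
have q1 : (0 < #|F|.-1)%N by rewrite -subn1 subn_gt0 finNzRing_gt1.
apply/eqP; rewrite -(eqn_pmul2r q1).
have -> : (#|F| * #|F|.-1 * #|F|.+1 * #|F|.-1 = #|('GL_2[F])%g|)%N.
  by rewrite card_GL_2; lia.
have -> : #|F|.-1 = #|[pred c : F | c != 0]|.
  by rewrite -(cardC1 (0 : F)); apply: eq_card => c; rewrite !inE.
apply/eqP; rewrite mulnC -sum_nat_const -[RHS]sum1_card.
rewrite [RHS](partition_big (fun g => \det (GLval g)) [pred c : F | c != 0]) /=; last first.
  by move=> g _; exact: (GL_det g).
apply: eq_bigr => c c0; rewrite sum1dep_card.
pose D : 'M[F]_2 := \matrix_(i, j) if i == j then if i == 0 then c else 1 else 0.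
have dD : \det D = c by rewrite det22 !mxE /= mulr1 mulr0 subr0.
have uD : D \is a GRing.unit by rewrite unitmxE dD unitfE.
pose h : {'GL_2[F]} := FinRing.unit _ uD.
rewrite -(card_rcoset (SL2 F) h); apply: eq_card => g.
rewrite mem_rcoset !inE GL_ME det_mulmx GL_VE det_inv dD /=.
by rewrite -[_ == 1](inj_eq (mulIf c0)) divfK // mul1r.
Qed.

Variable p : nat.
Hypothesis p_pr : prime p.
Let F := 'F_p.
Implicit Types (L P : {group {'GL_2[F]}}) (g x y : {'GL_2[F]}).

Lemma card_SL2_Fp : #|SL2 F| = (p * (p.-1 * p.+1))%N.
Proof. by rewrite card_SL2 card_Fp // mulnA. Qed.

Lemma GLval_inj : injective (@GLval 2 F).
Proof. by move=> x y xy; apply: val_inj. Qed.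

Lemma GLvalM x y : GLval (x * y)%g = GLval x *m GLval y :> 'M[F]_2.
Proof. by []. Qed.

Lemma GLvalXn y N k : GLval y = 1%:M + N -> N *m N = 0 ->
  GLval (y ^+ k)%g = 1%:M + N *+ k.
Proof.
move=> yN NN; elim: k => [|k IHk]; first by rewrite mulr0n addr0.
rewrite expgSr GL_MxE IHk yN mulmxDl mul1mx mulmxDr mulmx1 -scaler_nat -scalemxAl NN.
by rewrite scaler0 addr0 mulrSr [_ *+ k + N]addrC addrA scaler_nat.
Qed.

Lemma Fp_mulrn_p (V : lmodType F) (v : V) : v *+ p = 0.
Proof. by rewrite -scaler_nat pchar_Fp_0 // scale0r. Qed.

(** By Cayley-Hamilton N = y - 1 has square 0, so y^p = 1 + p N = 1. *)
Lemma unipotent_expgp y : \det (GLval y) = 1 -> \tr (GLval y) = 2 -> (y ^+ p)%g = 1%g.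
Proof.
move=> dy ty; have cy := cayley_hamilton22 (GLval y).
apply: GLval_inj; rewrite (@GLvalXn y (GLval y - 1%:M)) ?Fp_mulrn_p ?addr0 //.
  by rewrite addrC subrK.
rewrite mulmxBl mulmxBr mul1mx mulmx1 cy dy ty scaler_nat mulr2n.
by apply/matrixP=> i j; rewrite !mxE; ring.
Qed.

Lemma SL2_det g : g \in SL2 F -> \det (GLval g) = 1.
Proof. by rewrite inE => /eqP. Qed.

(** The prime p divides p (p - 1) (p + 1) exactly once. *)
Lemma pgroup_SL2_card P : P \subset SL2 F -> (p.-group P)%g -> #|P| = 1%N \/ #|P| = p.
Proof.
move=> sPS pP; have /p_natP[k cP] := pP.
have := cardSg sPS; rewrite cP card_SL2_Fp.
case: k cP => [|[|k]] cP; [by left|by right; rewrite expn1|].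
rewrite expnS dvdn_pmul2l ?prime_gt0 // => d; exfalso.
have p1 := prime_gt1 p_pr.
have : (p %| p.-1 * p.+1)%N by apply: dvdn_trans d; apply: dvdn_exp.
rewrite Euclid_dvdM // => /orP[|]; first by rewrite gtnNdvd //; lia.
by rewrite -addn1 dvdn_addr // dvdn1; lia.
Qed.


(** The action on the stable line is a character of [L]; its kernel is a p-group, hence cyclic of
    order 1 or p, and its image is cyclic as a finite multiplicative group of a field. The extension
    [K] lets the line be defined over a larger field, as non-split tori require. *)
Lemma fixed_line_generated (K : fieldType) (iota : {rmorphism F -> K}) L
    (v : 'rV[K]_2) :
  L \subset SL2 F -> v != 0 ->
  (forall y, y \in L -> exists c, v *m map_mx iota (GLval y) = c *: v) ->
  generated_by 2 L.
Proof.
move=> sLS v0 vL; pose m y := map_mx iota (GLval y).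
have mM x y : m (x * y)%g = m x *m m y by rewrite /m GL_MxE map_mxM.
have [i vi] : exists i, v 0 i != 0.
  apply/existsP; apply: contraR v0 => /existsPn v0.
  by apply/eqP/matrixP=> j i; rewrite ord1 mxE; apply/eqP; have := v0 i; rewrite negbK.
pose f y := (v *m m y) 0 i / v 0 i.
have fP y : y \in L -> v *m m y = f y *: v.
  by move=> /vL[c vc]; rewrite /f vc mxE mulfK.
have fM : {in L &, {morph f : x y / (x * y)%g >-> x * y}}.
  move=> x y xL yL; apply: (mulIf vi).
  have e : f (x * y)%g *: v = (f x * f y) *: v.
    by rewrite -fP ?groupM // mM mulmxA fP // -scalemxAl fP // scalerA.
  by have := congr1 (fun w : 'rV_2 => w 0 i) e; rewrite !mxE.
have f1 : f 1%g = 1 by rewrite /f /m GL_1E map_mx1 mulmx1 divff.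
pose Q := [set y in L | f y == 1].
have gQ : group_set Q.
  apply/group_setP; split=> [|x y]; first by rewrite inE group1 f1 eqxx.
  rewrite !inE => /andP[xL /eqP fx] /andP[yL /eqP fy].
  by rewrite groupM // fM // fx fy mulr1 eqxx.
pose P := Group gQ.
have sPL : P \subset L by apply/subsetP=> x; rewrite inE => /andP[].
have pP : (p.-group P)%g.
  apply/pgroupP=> q q_pr /(Cauchy q_pr)[x]; rewrite inE => /andP[xL /eqP fx] ox.
  have dx : \det (GLval x) = 1 by apply/SL2_det/(subsetP sLS).
  (* As 1 is an eigenvalue, det(x - 1) = det x - tr x + 1 vanishes. *)
  have tx : \tr (GLval x) = 2.
    have : \det (m x - 1%:M) == 0.
      apply/det0P; exists v => //.
      by rewrite mulmxBr mulmx1 fP // fx scale1r subrr.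
    have -> : m x - 1%:M = map_mx iota (GLval x - 1%:M) by rewrite map_mxB map_mx1.
    rewrite det_map_mx fmorph_eq0 det22_sub1 dx addrAC subr_eq0 => /eqP <-.
    by rewrite -[2]/(1 + 1).
  have := unipotent_expgp dx tx; move/eqP; rewrite -order_dvdn ox.
  by rewrite dvdn_prime2 // => /eqP->; rewrite inE.
have nPL : L \subset ('N(P))%g.
  apply/subsetP=> g gL; rewrite inE; apply/subsetP=> _ /imsetP[x + ->].
  rewrite !inE => /andP[xL /eqP fx]; rewrite groupJ //= conjgE.
  by rewrite fM ?groupM ?groupV // fM ?groupV // fx mul1r -fM ?groupV // mulVg f1.
have cP : cyclic P.
  have [P1|Pp] := pgroup_SL2_card (subset_trans sPL sLS) pP.
    by rewrite (card1_trivg P1) cyclic1.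
  by rewrite prime_cyclic ?Pp.
have cLP : cyclic (L / P)%g.
  have fr y : y \in L -> f (repr (coset P y)) = f y.
    move=> yL; have yN := subsetP nPL y yL.
    have := mem_repr_coset (coset P y); rewrite val_coset // => /rcosetP[k kP ->].
    by have := kP; rewrite inE => /andP[kL /eqP fk]; rewrite fM // fk mul1r.
  (* The character is constant on cosets of [P], so it can be evaluated at representatives, and it
     is injective on the quotient. *)
  apply: (@field_mul_group_cyclic _ _ _ (fun xb : coset_of P => f (repr xb))).
    move=> _ _ /morphimP[x xN xL ->] /morphimP[y yN yL ->].
    by rewrite -morphM // !fr ?groupM // fM.
  move=> _ /morphimP[x xN xL ->]; rewrite fr //; split=> [fx|/coset_idr].
    by apply: coset_id; rewrite inE xL fx eqxx.
  by move/(_ xN); rewrite inE => /andP[_ /eqP].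
apply: (generated_by_extension (a := 1) (b := 1) (f := coset P)) => //.
  by rewrite ker_coset (setIidPr sPL); apply: generated_by_cyclic.
exact: generated_by_cyclic.
Qed.

(** A generator u of [P] is unipotent, so its fixed vectors form a line, and the normaliser of [P]
    preserves this line. *)
Lemma normalised_Sylow_generated L P :
  L \subset SL2 F -> P \subset SL2 F -> #|P| = p -> L \subset ('N(P))%g ->
  generated_by 2 L.
Proof.
move=> sLS sPS cP nPL.
have /cyclicP[u defP] : cyclic P by rewrite prime_cyclic ?cP.
have uS : u \in SL2 F by rewrite (subsetP sPS) // defP cycle_id.
have ou : #[u]%g = p by rewrite /order -defP cP.
pose N : 'M[F]_2 := GLval u - 1%:M.
have N0 : N != 0.
  rewrite subr_eq0; apply: contraTneq (prime_gt1 p_pr) => u1.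
  by rewrite -ou (_ : u = 1%g) ?order1 //; apply: GLval_inj; rewrite u1 GL_1E.
(* Frobenius for commuting matrices in characteristic p: (u - 1)^p = u^p - 1 = 0. *)
have NX : (N : 'M_2) ^+ p = 0.
  have pc : p \in [pchar 'M[F]_2].
    by rewrite inE p_pr /=; apply/eqP; apply: Fp_mulrn_p.
  have := pFrobenius_autB_comm pc (commr1 (GLval u : 'M_2)).
  rewrite !pFrobenius_autE expr1n -[1]/(1%:M) -/N => ->.
  suff -> : (GLval u : 'M_2) ^+ p = 1%:M by rewrite subrr.
  have GX k : GLval (u ^+ k)%g = (GLval u : 'M_2) ^+ k.
    by elim: k => [|k IHk]; rewrite ?GL_1E // expgS exprS GL_MxE IHk.
  have up : (u ^+ p)%g = 1%g by apply/eqP; rewrite -order_dvdn ou.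
  by rewrite -GX up GL_1E.
have dN : \det N == 0.
  have dX k : \det ((N : 'M_2) ^+ k) = \det N ^+ k.
    by elim: k => [|k IHk]; rewrite ?det1 // !exprS -[_ * _ ^+ k]/(_ *m _) det_mulmx IHk.
  have := congr1 (@determinant F 2) NX; rewrite det0 dX => /eqP.
  by rewrite expf_eq0 => /andP[].
have /det0P[v v0 vN] := dN.
have vu : v *m GLval u = v.
  by apply/eqP; rewrite -subr_eq0 -[X in _ - X]mulmx1 -mulmxBr vN.
have vP x : x \in P -> v *m GLval x = v.
  rewrite defP => /cycleP[k ->]; elim: k => [|k IHk]; first by rewrite GL_1E mulmx1.
  by rewrite expgS GL_MxE mulmxA vu.
apply: (@fixed_line_generated _ (idfun : {rmorphism F -> F}) L v) => // y yL.
have -> : map_mx idfun (GLval y) = GLval y by apply/matrixP=> i j; rewrite mxE.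
apply: (kernel_line N0 v0 vN).
rewrite mulmxBr mulmx1; apply/eqP; rewrite subr_eq0 -mulmxA -GLvalM.
have -> : (y * u = u ^ y^-1 * y)%g by rewrite conjgE invgK -!mulgA mulVg mulg1.
rewrite GL_MxE mulmxA vP // memJ_norm ?groupV ?(subsetP nPL) //.
by rewrite defP cycle_id.
Qed.

(** The number n is 1 modulo p and divides p^2 - 1. If n > 1 and e is the cofactor, then p divides e
    + 1, while n >= p + 1 forces e <= p - 1; hence e = p - 1. *)
Lemma card_Syl_SL2 L : L \subset SL2 F ->
  #|('Syl_p(L))%g| = 1%N \/ #|('Syl_p(L))%g| = p.+1.
Proof.
move=> sLS; set n := #|_|; have nm : (n %% p = 1)%N by apply: card_Syl_mod.
have p1 := prime_gt1 p_pr.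
have : (n %| p.-1 * p.+1)%N.
  have cn : coprime n p by rewrite coprime_sym prime_coprime // /dvdn nm.
  rewrite -(Gauss_dvdr _ cn) -card_SL2_Fp.
  exact: dvdn_trans (card_Syl_dvd _ _) (cardSg sLS).
case/dvdnP=> e en; have nj := divn_eq n p; rewrite nm in nj.
move: (n %/ p)%N nj => [|j] nj; first by left.
right; have d : (p %| e.+1)%N.
  have e1 : (p * p = e * (j.+1 * p) + e.+1)%N.
    have -> : (p * p = (p.-1 * p.+1).+1)%N by case: (p) p1 => // q _; lia.
    by rewrite en nj mulnDr muln1 addnS.
  by rewrite -(dvdn_addr _ (dvdn_mull e (dvdn_mull j.+1 (dvdnn p)))) -e1 dvdn_mulr.
have := dvdn_leq (ltn0Sn e) d => pe.
have ep : (e <= p.-1)%N.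
  rewrite -(leq_pmul2r (ltn0Sn p)) en leq_mul2l nj addn1 ltnS leq_pmull ?orbT //.
have {}pe : e = p.-1 by lia.
by move: en; rewrite pe => /eqP; rewrite eqn_pmul2l; [move/eqP->|lia].
Qed.

End SpecialLinear.

(** * Subgroups of order divisible by p, and subgroups of tori *)

Section SubgroupsOfSL2.
Import GRing.Theory.
Local Open Scope ring_scope.
Variable p : nat.
Hypothesis p_pr : prime p.
Let F := 'F_p.
Implicit Types (L P : {group {'GL_2[F]}}) (g x y : {'GL_2[F]}).

(** A single Sylow subgroup is normalised by [L]. Otherwise two of them, P and Q, generate a
    subgroup M having all p + 1 Sylow subgroups, and a Frattini argument gives L = M N_L(P), with
    two generators for each factor. *)
Lemma SL2_generated_p_dvd L : L \subset SL2 F -> (p %| #|L|)%N -> generated_by 4 L.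
Proof.
move=> sLS /(Cauchy p_pr)[x xL ox].
have [||P sylP sxP] := @Sylow_superset p _ L <[x]>%G.
- by rewrite cycle_subG.
- by rewrite /pgroup /= -/(order x) ox pnat_id.
have cardp (Q : {group {'GL_2[F]}}) : (p.-Sylow(L) Q)%g -> #|Q| = p.
  move=> sylQ; rewrite (card_Hall sylQ) -(card_Hall sylP).
  have [P1|//] := pgroup_SL2_card p_pr (subset_trans (pHall_sub sylP) sLS) (pHall_pgroup sylP).
  by have := subset_leq_card sxP; rewrite -/(order x) ox P1 leqNgt prime_gt1.
have sPL := pHall_sub sylP.
have genN : generated_by 2 ('N_L(P))%g.
  apply: (@normalised_Sylow_generated _ p_pr _ P); rewrite ?subsetIr ?(cardp _ sylP) //.
    exact: subset_trans (subsetIl _ _) sLS.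
  exact: subset_trans sPL sLS.
have [n1|np] := card_Syl_SL2 p_pr sLS.
  apply: (@generated_byW _ 2) => //; have -> // : L :=: ('N_L(P))%g.
  apply/eqP; rewrite eqEsubset subsetIl andbT -indexg_eq1.
  by rewrite -(card_Syl sylP) n1.
have [Q sylQ QP] : exists2 Q : {group {'GL_2[F]}}, (p.-Sylow(L) Q)%g & Q != P.
  have : (0 < #|('Syl_p(L))%g :\ P|)%N.
    have := cardsD1 P ('Syl_p(L))%g; rewrite np inE sylP.
    by have := prime_gt0 p_pr; lia.
  by case/card_gt0P=> Q; rewrite !inE => /andP[QP sylQ]; exists Q.
pose M := (P <*> Q)%G.
have sML : M \subset L by rewrite join_subG sPL (pHall_sub sylQ).
have sylPM : (p.-Sylow(M) P)%g by apply: pHall_subl sML sylP; apply: joing_subl.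
have sylQM : (p.-Sylow(M) Q)%g by apply: pHall_subl sML sylQ; apply: joing_subr.
have npM : #|('Syl_p(M))%g| = p.+1.
  have [n1|//] := card_Syl_SL2 p_pr (subset_trans sML sLS).
  have /eqP/cards1P[T defT] := n1.
  have PT : P \in [set T] by rewrite -defT inE.
  have QT : Q \in [set T] by rewrite -defT inE.
  by move: QP; rewrite (set1P PT) (set1P QT) eqxx.
have cycS (T : {group {'GL_2[F]}}) : (p.-Sylow(L) T)%g -> generated_by 1 T.
  by move=> sylT; apply: generated_by_cyclic; rewrite prime_cyclic ?cardp.
have genM : generated_by 2 M by apply: (generated_by_join (cycS _ sylP) (cycS _ sylQ)).
suff -> : L :=: (M <*> 'N_L(P))%g by apply: (generated_by_join genM genN).
apply/eqP; rewrite eqEsubset join_subG sML subsetIl !andbT.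
suff defL : (M * 'N_L(P))%g = L.
  by rewrite -{1}defL mul_subG // ?joing_subl ?joing_subr.
apply/eqP; rewrite eqEcard mul_subG ?subsetIl //=.
(* Since |L : N_L(P)| and |M : N_M(P)| both equal p + 1, the product M N_L(P) has as many elements
   as [L]. *)
have := mul_cardG M ('N_L(P))%G; rewrite /= setIA (setIidPl sML) => e.
have N0 : (0 < #|('N_M(P))%g|)%N by apply: cardG_gt0.
rewrite -(leq_pmul2r N0) -e.
have := Lagrange (subsetIl L ('N(P))%g); have := Lagrange (subsetIl M ('N(P))%g).
rewrite -(card_Syl sylP) -(card_Syl sylPM) np npM /= => <- <-.
by apply/eq_leq; ring.
Qed.

(** Over an algebraic closure x has an eigenvector; as x is not scalar the eigenspace is a line, and
    everything commuting with x preserves it. *)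
Lemma torus_generated L x : L \subset SL2 F -> ~~ is_scalar_mx (GLval x) ->
  L \subset ('C[x])%g -> generated_by 2 L.
Proof.
move=> sLS nsx sLC.
have [K [iota _]] := countable_algebraic_closure F.
pose X := map_mx iota (GLval x).
have [a] : exists a, root (char_poly X) a by apply/closed_rootP; rewrite size_char_poly.
rewrite -eigenvalue_root_char => /eigenvalueP[v vX v0].
have N0 : X - a%:M != 0.
  apply: contra nsx => /eqP/subr0_eq/matrixP eX; apply/is_scalar_mxP.
  exists (GLval x 0 0); apply: mx22P; rewrite !mxE /= ?mulr1n ?mulr0n //.
  - by have := eX 0 1; rewrite !mxE /= mulr0n => /eqP; rewrite fmorph_eq0 => /eqP.
  - by have := eX 1 0; rewrite !mxE /= mulr0n => /eqP; rewrite fmorph_eq0 => /eqP.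
  - apply: (fmorph_inj iota).
    by have := eX 1 1; have := eX 0 0; rewrite !mxE /= mulr1n => -> ->.
have vN : v *m (X - a%:M) = 0 by rewrite mulmxBr vX mul_mx_scalar subrr.
apply: (@fixed_line_generated p p_pr K iota L v) => // y yL.
apply: (kernel_line N0 v0 vN).
have /cent1P xy := subsetP sLC y yL.
have XY : X *m map_mx iota (GLval y) = map_mx iota (GLval y) *m X.
  by rewrite -!map_mxM -!GLvalM xy.
by rewrite mulmxBr -mulmxA -XY mulmxA vX mul_mx_scalar scalemxAl subrr.
Qed.


Lemma GLval_trace_conj x y : \tr (GLval (x ^ y)%g) = \tr (GLval x).
Proof.
have -> : (x ^ y = y^-1 * (x * y))%g by rewrite conjgE.
by rewrite GLvalM mxtrace_mulC -GLvalM mulgK.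
Qed.

Hypothesis p_gt2 : (2 < p)%N.

Lemma Fp_two_neq0 : 2 != 0 :> F.
Proof.
apply/eqP=> e; have := pchar_Fp p_pr => pc.
have : (p %| 2)%N by rewrite (dvdn_pcharf pc) e.
by move/(dvdn_leq (isT : 0 < 2)%N); lia.
Qed.

(** If the discriminant vanished, x^2 would have trace 2 and determinant 1, hence order dividing p;
    being prime to p, this order is 1. Then Cayley-Hamilton reads (tr x) x = 2, and x would be
    scalar. *)
Lemma pprime_discriminant L x : L \subset SL2 F -> ~~ (p %| #|L|)%N ->
  x \in L -> ~~ is_scalar_mx (GLval x) -> \tr (GLval x) ^+ 2 - 4 != 0.
Proof.
move=> sLS pL xL; apply: contra => /eqP d.
have dx := SL2_det (subsetP sLS _ xL).
have cx := cayley_hamilton22 (GLval x).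
have tx : \tr (GLval (x * x)%g) = 2.
  rewrite GLvalM cx raddfB /= mxtraceZ mxtrace_scalar dx -mulr_natr mul1r -expr2.
  by rewrite -[RHS]add0r -d; ring.
have dxx : \det (GLval (x * x)%g) = 1 by rewrite GLvalM det_mulmx dx mulr1.
have x2 : (x * x)%g = 1%g.
  apply/eqP; rewrite -order_eq1 -dvdn1.
  have := unipotent_expgp p_pr dxx tx => /eqP; rewrite -order_dvdn => op.
  have oL : (#[(x * x)%g]%g %| #|L|)%N by rewrite order_dvdG // groupM.
  have : (#[(x * x)%g]%g %| gcdn p #|L|)%N by rewrite dvdn_gcd op.
  by have /eqP -> : coprime p #|L| by rewrite prime_coprime.
move: cx; rewrite -GLvalM x2 GL_1E dx => cx.
have t0 : \tr (GLval x) != 0.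
  apply: contraNneq Fp_two_neq0 => t0; move: d; rewrite t0 expr0n /= sub0r => /eqP.
  by rewrite oppr_eq0 (_ : 4 = 2 * 2 :> F) ?mulf_eq0 ?orbb //; ring.
have e : \tr (GLval x) *: GLval x = 2%:M.
  by rewrite -[LHS](subrK 1%:M) -cx -raddfD.
apply/is_scalar_mxP; exists (2 / \tr (GLval x)).
by rewrite -[LHS](scalerK t0) e scale_scalar_mx mulrC.
Qed.

End SubgroupsOfSL2.

(** * Bounded generation of all subgroups of SL_2(p) and PSL_2(p) *)

Section RankOfPSL2.
Import GRing.Theory.
Local Open Scope ring_scope.
Variable p : nat.
Hypotheses (p_pr : prime p) (p_gt2 : (2 < p)%N).
Let F := 'F_p.
Implicit Types (L P : {group {'GL_2[F]}}) (g x y : {'GL_2[F]}).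

(** The index counts the conjugates of x under the normaliser. Such a conjugate commutes with x, so
    it is a + b x with the same trace and determinant, and this leaves only x and tr x - x. *)
Lemma torus_normaliser_index L x : L \subset SL2 F -> ~~ (p %| #|L|)%N ->
  x \in L -> ~~ is_scalar_mx (GLval x) ->
  (#|'N_L('C_L[x]) : 'C_L[x]|%g <= 2)%N.
Proof.
move=> sLS pL xL nsx; set N := ('N_L('C_L[x]))%G.
have disc := pprime_discriminant p_pr p_gt2 sLS pL xL nsx.
have eC : ('C_L[x] = 'C_N[x])%g.
  apply/eqP; rewrite eqEsubset; apply/andP; split; last by apply/setSI/subsetIl.
  apply/subsetIP; split; last exact: subsetIr.
  by apply/subsetIP; split; [exact: subsetIl|exact: normG].
suff : (#|N : 'C_N[x]|%g <= 2)%N by rewrite -eC.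
rewrite index_cent1.
have dx := SL2_det (subsetP sLS _ xL).
have key y : y \in (x ^: N)%g -> y != x -> GLval y = (\tr (GLval x))%:M - GLval x.
  case/imsetP=> n nN -> {y}; set y := (x ^ n)%g => yx.
  have nL : n \in L by case/setIP: nN.
  have : y \in ('C_L[x])%g.
    by case/setIP: nN => _ nn; rewrite memJ_norm // inE xL cent1id.
  case/setIP=> yL /cent1P xy.
  have [|a [b eY]] := @commute_mx22 _ (GLval x) (GLval y) nsx.
    by rewrite -!GLvalM xy.
  have ty := GLval_trace_conj x n; rewrite -/y in ty.
  have dy := SL2_det (subsetP sLS _ yL).
  set t := \tr (GLval x) in disc ty *.
  have e1 : 2 * a + b * t = t.
    by rewrite -{2}ty eY raddfD /= mxtraceZ mxtrace_scalar mulr_natl.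
  have e2 : a ^+ 2 + a * b * t + b ^+ 2 = 1.
    rewrite -[RHS]dy eY -[b ^+ 2]mulr1 -dx /t trace22 !det22 !mxE /= mulr1n mulr0n.
    by ring.
  (* Eliminating [a] from the trace and determinant relations leaves (t^2 - 4) (b^2 - 1) = 0. *)
  have b2 : (b - 1) * (b + 1) = 0.
    apply: (mulfI disc); rewrite mulr0.
    transitivity ((2 * a + b * t) ^+ 2 - t ^+ 2 - 4 * (a ^+ 2 + a * b * t + b ^+ 2 - 1)).
      by ring.
    by rewrite e1 e2 !subrr mulr0 subr0.
  move/eqP: b2; rewrite mulf_eq0 subr_eq0 addr_eq0 => /orP[/eqP b1|/eqP b1].
    case/eqP: yx; apply: GLval_inj; rewrite eY b1 scale1r.
    move: e1; rewrite b1 mul1r => /eqP; rewrite -[X in _ == X]add0r.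
    rewrite (inj_eq (addIr t)) mulf_eq0 (negbTE (Fp_two_neq0 p_pr p_gt2)) /= => /eqP ->.
    by rewrite raddf0 add0r.
  rewrite eY b1 scaleN1r; congr (_%:M - _); apply: (mulfI (Fp_two_neq0 p_pr p_gt2)).
  by rewrite -[LHS](addrK (b * t)) e1 b1; ring.
have [sub|/subsetPn[y0 y0N y0x]] := boolP ((x ^: N)%g \subset [set x]).
  by apply: leq_trans (subset_leq_card sub) _; rewrite cards1.
rewrite inE in y0x.
apply: leq_trans (_ : #|[set x; y0]| <= 2)%N; last by rewrite cards2; case: (_ != _).
apply/subset_leq_card/subsetP=> y yN; rewrite !inE; have [//|yx /=] := eqVneq y x.
by apply/eqP/GLval_inj; rewrite (key _ yN yx) (key _ y0N y0x).
Qed.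

(** When p does not divide |L|, either [L] is scalar, and preserves any line, or some torus has
    index at most 60 < 2^6 in it, giving 2 + 6 generators. *)
Lemma SL2_generated L : L \subset SL2 F -> generated_by 8 L.
Proof.
move=> sLS; have [pL|pL] := boolP (p %| #|L|)%N.
  by apply: generated_byW (SL2_generated_p_dvd p_pr sLS pL).
pose Z := [set x in L | is_scalar_mx (GLval x)].
have gZ : group_set Z.
  apply/group_setP; split=> [|x y].
    by rewrite inE group1 GL_1E scalar_mx_is_scalar.
  rewrite !inE => /andP[xL /is_scalar_mxP[a ea]] /andP[yL /is_scalar_mxP[b eb]].
  by rewrite groupM // GLvalM ea eb -scalar_mxM scalar_mx_is_scalar.
have TP x : x \in L :\: Group gZ -> x \in L /\ ~~ is_scalar_mx (GLval x).
  by rewrite !inE => /andP[+ xL]; rewrite xL.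
have [||||eZ|[x /TP[xL nsx] Lx]] := @partition_by_centralisers _ L (Group gZ).
- by apply/subsetP=> x; rewrite inE => /andP[].
- apply/subsetP=> x xL; apply/centP=> y; rewrite inE => /andP[yL /is_scalar_mxP[a ea]].
  by apply: GLval_inj; rewrite !GLvalM ea scalar_mxC.
- move=> x /TP[xL nsx]; apply/centsP=> y /setIP[_ /cent1P xy] z /setIP[_ /cent1P xz].
  have com g : (x * g = g * x)%g -> GLval x *m GLval g = GLval g *m GLval x.
    by rewrite -!GLvalM => ->.
  have [a [b ey]] := commute_mx22 nsx (com _ (esym xy)).
  have [c [d ez]] := commute_mx22 nsx (com _ (esym xz)).
  apply: GLval_inj; rewrite !GLvalM; rewrite ey ez; apply: commute_affine22.
- by move=> x /TP[xL nsx]; apply: torus_normaliser_index.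
- apply: (@generated_byW _ 2) => //.
  apply: (@fixed_line_generated p p_pr _ (idfun : {rmorphism F -> F}) L (const_mx 1)) => //.
    by apply/eqP=> /matrixP/(_ 0 0)/eqP; rewrite !mxE oner_eq0.
  move=> y; rewrite eZ inE => /andP[_ /is_scalar_mxP[a ea]].
  by exists a; rewrite ea map_scalar_mx mul_mx_scalar.
apply: (@generated_by_index _ 2 6 ('C_L[x])%G); first exact: subsetIl.
  have : (#|L : 'C_L[x]|%g <= 60)%N.
    by rewrite -(leq_pmul2l (cardG_gt0 ('C_L[x])%G)) Lagrange ?subsetIl // mulnC.
  by move/leq_trans; apply.
apply: (torus_generated p_pr _ nsx); last exact: subsetIr.
exact: subset_trans (subsetIl _ _) sLS.
Qed.

Lemma PSL2_generated (L : {group {perm P1 F}}) :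
  L \subset PSL2_P1 F -> generated_by 8 L.
Proof.
move=> sLS; have <- : (actperm (P1_act F) @* (SL2 F :&: actperm (P1_act F) @*^-1 L))%g = L.
  by rewrite morphim_setIpre (setIidPr sLS).
apply: generated_by_morphim; first exact: subset_trans (subsetIl _ _) (subsetT _).
apply: (@SL2_generated (SL2_group F :&: (actperm (P1_act F) @*^-1 L))%G).
exact: subsetIl.
Qed.

End RankOfPSL2.

(** * Two unipotent generators of PSL_2(p) *)

Section GeneratorsOfPSL2.
Import GRing.Theory.
Local Open Scope ring_scope.
Variable p : nat.
Hypothesis p_pr : prime p.
Let F := 'F_p.
Implicit Types (g x y : {'GL_2[F]}).

Lemma card_PSL2_le : (#|PSL2_P1 F| <= p ^ 3)%N.
Proof.
apply: leq_trans (leq_morphim _ _) _; rewrite (card_SL2_Fp p_pr).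
by have := prime_gt0 p_pr; rewrite !expnS; nia.
Qed.

Lemma P1_act_fixes_line g (v : 'rV[F]_2) :
  v != 0 -> v *m GLval g = v -> exists t : P1 F, actperm (P1_act F) g t = t.
Proof.
move=> v0 vg; have Lv : is_line [set c *: v | c : F].
  by apply/existsP; exists v; rewrite v0 eqxx.
exists (exist (@is_line F) _ Lv : P1 F); rewrite actpermE; apply: val_inj => /=.
apply/setP=> w; apply/imsetP/idP => [[x /imsetP[c _ ->] ->]|wL].
  by rewrite -scalemxAl vg; apply/imsetP; exists c.
by exists w => //; case/imsetP: wL => c _ ->; rewrite -scalemxAl vg.
Qed.

(** Over a prime field the powers of an elementary transvection are all transvections in its root
    subgroup, and three transvections multiply to any matrix whose lower left entry is nonzero. *)
Lemma SL2_generators : exists g h : {'GL_2[F]},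
  [/\ GLval g = transvection_mx 0 1 1, GLval h = transvection_mx 1 0 1 &
   SL2 F = <<[set g; h]>>%g].
Proof.
have [g gS eg] := SL2_mem_ex (@det_transvection F 0 1 1 isT).
have [h hS eh] := SL2_mem_ex (@det_transvection F 1 0 1 isT).
exists g, h; split=> //; set E := <<_>>%g.
have pow (i j : 'I_2) x t : i != j -> GLval x = transvection_mx i j 1 ->
    exists k, GLval (x ^+ k)%g = transvection_mx i j t.
  move=> ij ex; exists (t : nat).
  rewrite (GLvalXn (N := delta_mx i j)); first last.
  - by rewrite mul_delta_mx_0 // eq_sym.
  - by rewrite ex /transvection_mx scale1r.
  by rewrite /transvection_mx -[in RHS](natr_Zp t) scaler_nat.
have gE t : exists2 x, x \in E & GLval x = transvection_mx 0 1 t.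
  have [k ek] := @pow 0 1 g t isT eg; exists (g ^+ k)%g => //.
  by rewrite groupX // /E mem_gen // set21.
have hE t : exists2 x, x \in E & GLval x = transvection_mx 1 0 t.
  have [k ek] := @pow 1 0 h t isT eh; exists (h ^+ k)%g => //.
  by rewrite groupX // /E mem_gen // set22.
apply/eqP; rewrite eqEsubset; apply/andP; split; last first.
  by rewrite gen_subG; apply/subsetP=> x /set2P[]->.
have main x : x \in SL2 F -> GLval x 1 0 != 0 -> x \in E.
  move=> /SL2_det dx c0; set M := GLval x in dx c0.
  have [y yE ey] := gE ((M 0 0 - 1) / M 1 0).
  have [z zE ez] := hE (M 1 0).
  have [w wE ew] := gE ((M 1 1 - 1) / M 1 0).
  suff -> : x = (y * z * w)%g by rewrite !groupM.
  apply: GLval_inj; rewrite !GLvalM ey ez ew -/M.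
  exact: transvection_decomposition.
(* If the lower left entry is 0, then the upper left one is not, and a lower transvection adds it to
   the lower left. *)
apply/subsetP=> x xS; have [c0|] := eqVneq (GLval x 1 0) 0; last exact: main.
have [z zE ez] := hE 1.
have zS : z \in SL2 F by rewrite inE ez; apply/eqP/det_transvection.
rewrite -(groupMl _ zE); apply: main; first exact: groupM.
rewrite GLvalM ez transvection_mulmx10 c0 addr0.
have := SL2_det xS; rewrite det22 c0 mulr0 subr0 => d.
by apply: contra_eq_neq d => ->; rewrite mul0r eq_sym oner_eq0.
Qed.

Lemma PSL2_generators : exists u l : {perm P1 F},
  [/\ PSL2_P1 F = <<[set u; l]>>%g, (u ^+ p = 1)%g, (l ^+ p = 1)%g, u <> 1%g &
   (exists t, u t = t) /\ (exists t, l t = t)].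
Proof.
have [g [h [eg eh defS]]] := SL2_generators.
have xp x i j : i != j -> GLval x = transvection_mx i j 1 -> (x ^+ p = 1)%g.
  move=> ij ex; apply: (unipotent_expgp p_pr); rewrite ex.
    exact: det_transvection.
  exact: trace_transvection.
pose a := actperm (P1_act F).
exists (a g), (a h); split.
- rewrite /PSL2_P1 defS morphim_gen; last exact: subsetT.
  by rewrite morphimU !morphim_set1 ?inE.
- by rewrite -morphX ?inE // (xp _ 0 1) // morph1.
- by rewrite -morphX ?inE // (xp _ 1 0) // morph1.
- move=> ag1; have /P1_act_ker_scalar[b eb] : forall L, P1_act F L g = L.
    by move=> L; rewrite -actpermE -/a ag1 perm1.
  move/matrixP: eb => /(_ 0 1)/eqP.
  by rewrite eg !mxE /= mulr0n add0r mulr1 oner_eq0.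
split; [apply: (@P1_act_fixes_line g (delta_mx 0 1))|apply: (@P1_act_fixes_line h (delta_mx 0 0))].
- by apply/eqP=> /matrixP/(_ 0 1)/eqP; rewrite !mxE oner_eq0.
- by rewrite eg /transvection_mx scale1r mulmxDr mulmx1 mul_delta_mx_0 // addr0.
- by apply/eqP=> /matrixP/(_ 0 0)/eqP; rewrite !mxE oner_eq0.
- by rewrite eh /transvection_mx scale1r mulmxDr mulmx1 mul_delta_mx_0 // addr0.
Qed.

(** The symmetric group on the projective line contains an element of order p, so p divides the
    factorial of the number of points. *)
Lemma leq_card_P1 : (p <= #|P1 F|)%N.
Proof.
have [u [l [_ up _ u1 _]]] := PSL2_generators.
have ou : #[u]%g = p by apply: nt_prime_order => //; apply/eqP.
have : (p %| #|P1 F|`!)%N.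
  have -> : #|P1 F|`! = #|[set: {perm P1 F}]| by exact: esym (card_Sym (P1 F)).
  by have := @order_dvdG _ [set: {perm P1 F}]%G u (in_setT u); rewrite ou.
elim: #|P1 F| => [|n IHn]; first by rewrite fact0 dvdn1; have := prime_gt1 p_pr; lia.
rewrite factS Euclid_dvdM // => /orP[/dvdn_leq-> //|/IHn]; exact: leqW.
Qed.

End GeneratorsOfPSL2.

(** * Wreath products in product action *)

Section Wreath.
Local Open Scope group_scope.
Variables Omega Delta : finType.
Hypothesis Omega_gt1 : 1 < #|Omega|.
Variables (A : {group {perm Omega}}) (B : {group {perm Delta}}).
Implicit Types (a : {ffun Delta -> {perm Omega}}) (b : {perm Delta}).
Implicit Types (w : {perm {ffun Delta -> Omega}}) (D : {set Delta}).

(** Inverse of [pa_perm], which is injective as [Omega] has two points; the default value concerns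
    only permutations that are not of this form. *)
Definition pa_split w : {ffun Delta -> {perm Omega}} * {perm Delta} :=
  odflt ([ffun=> 1], 1) [pick ab | w == pa_perm ab.1 ab.2].

Lemma pa_splitE a b : pa_split (pa_perm a b) = (a, b).
Proof.
rewrite /pa_split; case: pickP => [[a' b'] /= /eqP/(pa_perm_inj Omega_gt1)[-> ->]//|].
by move/(_ (a, b)); rewrite eqxx.
Qed.

Lemma pa_baseP (a : {ffun Delta -> {perm Omega}}) :
  reflect (forall d, a d \in A) (a \in pa_base Delta A).
Proof. by rewrite inE; apply: forallP. Qed.

Lemma pa_split_sndM : {in pa_wreath A B &,
  {morph (fun w => (pa_split w).2) : v w / v * w}}.
Proof.
by move=> _ _ /imset2P[a b _ _ ->] /imset2P[a' b' _ _ ->]; rewrite pa_permM !pa_splitE.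
Qed.
Definition pa_snd := Morphism pa_split_sndM.

(** The factor A^D of the base group, from which coordinates are peeled off one at a time. *)
Definition pa_partial_base D : {set {perm {ffun Delta -> Omega}}} :=
  [set w | [exists a, [&& a \in pa_base Delta A, [forall d, (d \notin D) ==> (a d == 1)]
    & w == pa_perm a 1]]].

Lemma pa_partial_baseP D w : reflect
  (exists a, [/\ a \in pa_base Delta A, forall d, d \notin D -> a d = 1 & w = pa_perm a 1])
  (w \in pa_partial_base D).
Proof.
rewrite inE; apply: (iffP existsP) => [[a /and3P[aA /forall_inP aD /eqP ->]]|[a [aA aD ->]]].
  by exists a; split=> // d /aD/eqP.
by exists a; apply/and3P; split=> //; apply/forall_inP=> d /aD ->.
Qed.

Lemma pa_partial_base_group_set D : group_set (pa_partial_base D).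
Proof.
apply/group_setP; split=> [|_ _ /pa_partial_baseP[a [/pa_baseP aA aD ->]]
                               /pa_partial_baseP[b [/pa_baseP bA bD ->]]].
  apply/pa_partial_baseP; exists [ffun=> 1]; split; rewrite ?pa_perm1 //.
    by apply/pa_baseP=> d; rewrite ffunE group1.
  by move=> d _; rewrite ffunE.
rewrite pa_permM mulg1; apply/pa_partial_baseP; eexists; split; last by [].
  by apply/pa_baseP=> d; rewrite ffunE groupM.
by move=> d dD; rewrite ffunE invg1 perm1 aD // bD // mulg1.
Qed.
Canonical pa_partial_base_group D := Group (pa_partial_base_group_set D).

Lemma pa_eval_M D d : {in pa_partial_base D &,
  {morph (fun w => (pa_split w).1 d) : v w / v * w}}.
Proof.
move=> _ _ /pa_partial_baseP[a [_ _ ->]] /pa_partial_baseP[b [_ _ ->]].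
by rewrite pa_permM !pa_splitE ffunE invg1 perm1.
Qed.
Definition pa_eval D d := Morphism (@pa_eval_M D d).

Lemma ker_pa_eval D d :
  'ker_(pa_partial_base D) (pa_eval D d) = pa_partial_base (D :\ d).
Proof.
apply/setP=> w; apply/setIP/pa_partial_baseP => [[wD /mker /=]|[a [aA aD ->]]].
  case/pa_partial_baseP: wD => a [aA aD ->]; rewrite pa_splitE => ad.
  exists a; split=> // e; rewrite !inE negb_and negbK.
  by case: eqP => [->//|_]; apply: aD.
have wD : pa_perm a 1 \in pa_partial_base D.
  apply/pa_partial_baseP; exists a; split=> // e eD; apply: aD.
  by rewrite inE (negbTE eD) andbF.
split=> //; apply/kerP => //=; rewrite pa_splitE; apply: aD.
by rewrite !inE eqxx.
Qed.

Definition pa_single (d : Delta) (x : {perm Omega}) : {perm {ffun Delta -> Omega}} :=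
  pa_perm [ffun e => if e == d then x else 1] 1.

Lemma pa_single_partial_base D d x :
  d \in D -> x \in A -> pa_single d x \in pa_partial_base D.
Proof.
move=> dD xA; apply/pa_partial_baseP; eexists; split; last by [].
  by apply/pa_baseP=> e; rewrite ffunE; case: eqP; rewrite ?group1.
by move=> e eD; rewrite ffunE; case: eqP eD => // ->; rewrite dD.
Qed.

Lemma im_pa_eval D d : d \in D -> pa_eval D d @* pa_partial_base D = A.
Proof.
move=> dD; apply/setP=> x; apply/morphimP/idP => [[w _ wD ->]|xA] /=.
  case/pa_partial_baseP: wD => a [/pa_baseP aA _ ->]; rewrite pa_splitE; exact: aA.
have sD := pa_single_partial_base dD xA.
by exists (pa_single d x) => //=; rewrite pa_splitE ffunE eqxx.
Qed.

(** Induction on |D|: evaluation at a coordinate d maps onto [A], with the part of the base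
    supported off d as kernel. *)
Lemma card_subgroups_partial_base n s D :
  (forall L : {group {perm Omega}}, L \subset A -> generated_by s L) ->
  0 < n ->
  #|subgroups_index_le n (pa_partial_base D)| <=
    (#|subgroups_index_le n A| * n ^ s) ^ #|D|.
Proof.
move=> genA n0; move cD: #|D| => k; elim: k D cD => [|k IHk] D cD.
  have -> : pa_partial_base D = 1%g.
    apply/setP=> w; apply/pa_partial_baseP/set1gP => [[a [aA aD ->]]|->].
      have -> : a = [ffun=> 1] by apply/ffunP=> d; rewrite ffunE aD // (cards0_eq cD) inE.
      exact: pa_perm1.
    exists [ffun=> 1]; rewrite pa_perm1; split=> //; last by move=> d _; rewrite ffunE.
    by apply/pa_baseP=> d; rewrite ffunE group1.
  apply: leq_trans (subset_leq_card (_ : _ \subset [set 1%G])) _; last by rewrite cards1.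
  apply/subsetP=> H /setIdP[/trivgP H1 _]; apply/set1P; exact: val_inj.
have [d dD] : exists d, d \in D by apply/card_gt0P; rewrite cD.
have cD' : #|D :\ d| = k by have := cardsD1 d D; rewrite dD cD add1n => -[->].
have := @card_subgroups_extension _ _ _ (pa_eval D d) n s (pa_partial_base_group D).
rewrite /= ker_pa_eval im_pa_eval // => /(_ (subxx _) genA) /leq_trans; apply.
by rewrite expnSr -mulnA leq_mul2r IHk ?orbT.
Qed.

Lemma pa_partial_baseTP w :
  reflect (exists2 a, a \in pa_base Delta A & w = pa_perm a 1) (w \in pa_partial_base setT).
Proof.
apply: (iffP (pa_partial_baseP _ _)) => [[a [aA _ ->]]|[a aA ->]]; first by exists a.
by exists a; split=> // d; rewrite inE.
Qed.

Lemma ker_pa_snd : 'ker_(pa_wreath A B) pa_snd = pa_partial_base setT.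
Proof.
apply/setP=> w; apply/setIP/pa_partial_baseTP => [[wW /mker /=]|[a aA ->]].
  by case/imset2P: wW => a b aA bB ->; rewrite pa_splitE /= => ->; exists a.
have wW : pa_perm a 1 \in pa_wreath A B by apply: imset2_f.
by split=> //; apply/kerP => //=; rewrite pa_splitE.
Qed.

Lemma im_pa_snd : pa_snd @* pa_wreath A B = B.
Proof.
apply/setP=> b; apply/morphimP/idP => [[_ _ /imset2P[a b' _ bB ->] ->]|bB] /=.
  by rewrite pa_splitE.
have wW : pa_perm [ffun=> 1] b \in pa_wreath A B.
  by apply: imset2_f => //; apply/pa_baseP=> d; rewrite ffunE group1.
by exists (pa_perm [ffun=> 1] b) => //=; rewrite pa_splitE.
Qed.

Lemma card_pa_wreath_le : #|pa_wreath A B| <= #|A| ^ #|Delta| * #|B|.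
Proof.
apply: leq_trans (_ : #|setX (pa_base Delta A) B| <= _).
  rewrite /pa_wreath curry_imset2X; exact: leq_imset_card.
rewrite cardsX leq_mul2r; apply/orP; right.
rewrite -(card_ffun_on _ (mem A)) subset_leq_card //; apply/subsetP=> a /pa_baseP aA.
exact/ffun_onP.
Qed.

(* With n >= p > 2 ^ m, m the number of coordinates, all the factors are
   powers of n with exponent linear in m. *)
Lemma card_subgroups_pa_wreath n s :
  (forall L : {group {perm Omega}}, L \subset A -> generated_by s L) ->
  #|A| <= n ^ 3 -> #|B| <= 2 ^ #|Delta| -> 2 ^ #|Delta| <= n -> 
  #|subgroups_index_le n (pa_wreath A B)| <= n ^ ((4 * s + 2) * #|Delta|).
Proof.
move=> genA cA cB cn; set m := #|Delta|.
have n0 : 0 < n by apply: leq_trans cn; rewrite expn_gt0.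
have genB (L : {group {perm Delta}}) : L \subset B -> generated_by m L.
  by move=> LB; apply: generated_by_log; apply: leq_trans (subset_leq_card LB) cB.
have := @card_subgroups_extension _ _ _ pa_snd n m (pa_wreath_group A B).
rewrite /= ker_pa_snd im_pa_snd => /(_ (subxx _) genB) /leq_trans; apply.
(* The three summands account for subgroups of the base, subgroups of [B], and lifts of the at most
   m generators of the image. *)
have -> : ((4 * s + 2) * m = (4 * s) * m + m + m)%N by ring.
rewrite !expnD leq_mul2r; apply/orP; right; apply: leq_mul; last first.
  apply: leq_trans (card_subgroups_le _ genB) _.
  case: (posnP m) => [->//|m0]; rewrite leq_exp2r //; exact: leq_trans cn.
apply: leq_trans (card_subgroups_partial_base _ genA n0) _; rewrite cardsT -/m.
case: (posnP m) => [->|m0]; first by rewrite muln0.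
rewrite expnM leq_exp2r //; apply: leq_trans (leq_mul (card_subgroups_le n genA) (leqnn _)) _.
have -> : (4 * s = 3 * s + s)%N by ring.
rewrite expnD leq_mul2r expnM; apply/orP; right.
by case: (posnP s) => [->//|s0]; rewrite leq_exp2r.
Qed.

Lemma pa_singleM d x y : pa_single d (x * y) = pa_single d x * pa_single d y.
Proof.
rewrite /pa_single pa_permM mulg1; congr pa_perm; apply/ffunP=> e.
by rewrite !ffunE invg1 perm1; case: eqP; rewrite ?mulg1.
Qed.

Lemma pa_single1 d : pa_single d 1 = 1.
Proof. by rewrite -pa_perm1; congr pa_perm; apply/ffunP=> e; rewrite !ffunE if_same. Qed.

Lemma pa_singleX d x k : pa_single d (x ^+ k) = pa_single d x ^+ k.
Proof. by elim: k => [|k IHk]; rewrite ?pa_single1 // !expgS pa_singleM IHk. Qed.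

Lemma pa_singleJ d x b : pa_single d x ^ pa_perm [ffun=> 1] b = pa_single (b d) x.
Proof.
apply: (mulgI (pa_perm [ffun=> 1] b)); rewrite conjgE mulKVg !pa_permM mul1g mulg1.
congr pa_perm; apply/ffunP=> e.
by rewrite !ffunE mulg1 mul1g -(inj_eq (@perm_inj _ b)) permKV.
Qed.

Lemma pa_partial_base_sub (H : {group {perm {ffun Delta -> Omega}}}) :
  (forall d x, x \in A -> pa_single d x \in H) -> pa_partial_base setT \subset H.
Proof.
move=> sH; apply/subsetP=> w /pa_partial_baseTP[a /pa_baseP aA ->].
pose aD D := [ffun d => if d \in D then a d else 1].
suff key D : pa_perm (aD D) 1 \in H.
  by have := key setT; congr (pa_perm _ 1 \in H); apply/ffunP=> d; rewrite ffunE inE.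
move cD: #|D| => k; elim: k D cD => [|k IHk] D cD.
  rewrite (_ : pa_perm _ _ = 1) ?group1 // -pa_perm1; congr pa_perm.
  by apply/ffunP=> d; rewrite !ffunE (cards0_eq cD) inE.
have [d dD] : exists d, d \in D by apply/card_gt0P; rewrite cD.
have cD' : #|D :\ d| = k by have := cardsD1 d D; rewrite dD cD add1n => -[->].
suff -> : pa_perm (aD D) 1 = pa_perm (aD (D :\ d)) 1 * pa_single d (a d).
  by rewrite groupM ?IHk ?sH.
rewrite pa_permM mulg1; congr pa_perm; apply/ffunP=> e.
rewrite !ffunE invg1 perm1 !inE; case: eqP => [->|_] /=; first by rewrite dD mul1g.
by rewrite mulg1.
Qed.

Lemma pa_wreath_sub (H : {group {perm {ffun Delta -> Omega}}}) :
  (forall d x, x \in A -> pa_single d x \in H) ->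
  (forall b, b \in B -> pa_perm [ffun=> 1] b \in H) -> pa_wreath A B \subset H.
Proof.
move=> sH bH; apply/subsetP=> _ /imset2P[a b aA bB ->].
have -> : pa_perm a b = pa_perm [ffun d => a (b d)] 1 * pa_perm [ffun=> 1] b.
  rewrite pa_permM mul1g; congr pa_perm; apply/ffunP=> d.
  by rewrite !ffunE permKV mulg1.
rewrite groupM ?bH //; apply: (subsetP (pa_partial_base_sub sH)).
apply/pa_partial_baseTP; eexists; last by [].
by apply/pa_baseP=> d; rewrite ffunE; apply: (pa_baseP _ aA).
Qed.

(* An element of order p lies in every subgroup of index less than p. *)
Lemma pa_base_sub_small_index p u l (H : {group {perm {ffun Delta -> Omega}}}) :
  prime p -> A :=: <<[set u; l]>> -> u ^+ p = 1 -> l ^+ p = 1 ->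
  H \subset pa_wreath A B -> #|pa_wreath A B : H| < p ->
  pa_partial_base setT \subset H.
Proof.
move=> p_pr defA up lp sHW iH; apply: pa_partial_base_sub => d.
suff : A \subset [set x | pa_single d x \in H] by move/subsetP=> sA x /sA; rewrite inE.
have gA : group_set [set x | pa_single d x \in H].
  apply/group_setP; split=> [|x y]; rewrite !inE ?pa_single1 ?group1 //.
  by rewrite pa_singleM; apply: groupM.
rewrite defA; change (<<[set u; l]>> \subset Group gA); rewrite gen_subG /=.
have key x : x ^+ p = 1 -> x \in A -> pa_single d x \in H.
  move=> xp xA; set y := pa_single d x.
  have yW : y \in pa_wreath A B.
    apply: imset2_f; rewrite ?group1 //.
    by apply/pa_baseP=> e; rewrite ffunE; case: eqP; rewrite ?group1.
  have yp : #[y] %| p by rewrite order_dvdn -pa_singleX xp pa_single1.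
  (* The index of H in the group generated by y divides p and is less than p, so it is 1. *)
  have d1 : #|<[y]> : H| %| p by apply: dvdn_trans (dvdn_indexg _ _) yp.
  have d2 : #|<[y]> : H| < p.
    apply: leq_ltn_trans iH.
    rewrite -(leq_pmul2l (cardG_gt0 (<[y]> :&: H)%G)) -(leq_pmul2r (cardG_gt0 H)) /=.
    rewrite LagrangeI mul_cardG [leqLHS]mulnC -mulnA leq_mul2l [X in _ <= X]mulnC.
    by rewrite Lagrange // subset_leq_card ?orbT // mul_subG // cycle_subG.
  have /primeP[_ /(_ _ d1)/orP[/eqP i1|/eqP ip]] := p_pr.
    by apply: (subsetP _ _ (cycle_id y)); rewrite -indexg_eq1 i1.
  by rewrite ip ltnn in d2.
by apply/subsetP=> x /set2P[]->; rewrite inE key ?defA ?mem_gen ?set21 ?set22 //.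
Qed.

End Wreath.

(** * Generators of a wreath product, and many of its subgroups *)

Section WreathGeneration.
Local Open Scope group_scope.
Variables Omega Delta : finType.
Variables (A : {group {perm Omega}}) (B : {group {perm Delta}}).
Implicit Types (a : {ffun Delta -> {perm Omega}}) (b : {perm Delta}).

(** The base group alone is transitive: its entries are chosen independently at each coordinate. *)
Lemma pa_wreath_transitive :
  (forall x y, exists2 s, s \in A & s x = y) ->
  forall phi psi, exists2 w, w \in pa_wreath A B & w phi = psi.
Proof.
move=> trA phi psi.
have [a aA aE] := fin_all_exists2 (fun d : Delta => trA (phi d) (psi d)).
exists (pa_perm (finfun a) 1).
  by apply: imset2_f; rewrite ?group1 //; apply/pa_baseP=> d; rewrite ffunE.
by apply/ffunP=> d; rewrite pa_permE ffunE invg1 perm1.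
Qed.

Lemma pa_perm_expg a b k : (forall d, a (b^-1 d) = a d) ->
  pa_perm a b ^+ k = pa_perm [ffun d => a d ^+ k] (b ^+ k).
Proof.
move=> ab; elim: k => [|k IHk].
  by rewrite [LHS]expg0 -[LHS]pa_perm1; congr pa_perm; apply/ffunP=> d; rewrite !ffunE.
rewrite !expgSr IHk pa_permM; congr pa_perm; apply/ffunP=> d.
by rewrite !ffunE ab expgSr.
Qed.

Definition pa_lift (d : Delta) (x : {perm Omega}) b : {perm {ffun Delta -> Omega}} :=
  pa_perm [ffun e => if e == d then x else 1] b.

Let fixed_preim b d e : b d = d -> (b^-1 e == d) = (e == d).
Proof. by move=> bd; rewrite -(inj_eq (@perm_inj _ b)) permKV bd. Qed.

Lemma pa_liftE d (x : {perm Omega}) b : b d = d -> pa_lift d x b = pa_single d x * pa_perm [ffun=> 1] b.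
Proof.
move=> bd; rewrite pa_permM mul1g; congr pa_perm; apply/ffunP=> e.
by rewrite !ffunE mulg1 fixed_preim.
Qed.

Lemma pa_lift_fixed d (x : {perm Omega}) b t : x t = t -> pa_lift d x b [ffun=> t] = [ffun=> t].
Proof.
move=> xt; apply/ffunP=> e; rewrite pa_permE !ffunE.
by case: eqP => _; rewrite ?xt ?perm1.
Qed.

Lemma pa_lift_expg d (x : {perm Omega}) b k : b d = d -> pa_lift d x b ^+ k = pa_lift d (x ^+ k) (b ^+ k).
Proof.
move=> bd; rewrite pa_perm_expg; last first.
  by move=> e; rewrite !ffunE fixed_preim.
congr pa_perm; apply/ffunP=> e; rewrite !ffunE.
by case: eqP; rewrite // expg1n.
Qed.

(* The two factors commute and have coprime orders. *)
Lemma pa_lift_split (H : {group {perm {ffun Delta -> Omega}}}) p N d x b :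
  coprime p N -> x ^+ p = 1 -> b ^+ N = 1 -> b d = d -> pa_lift d x b \in H ->
  pa_single d x \in H /\ pa_perm [ffun=> 1] b \in H.
Proof.
move=> cpN xp bN bd yH.
have sH : pa_single d x \in H.
  (* The exponent is 1 modulo p and 0 modulo N, so this power keeps x and kills b. *)
  have := groupX (chinese p N 1 0) yH; rewrite pa_lift_expg //.
  rewrite -(expg_mod _ xp) chinese_modl // expg_mod // expg1.
  by rewrite -(expg_mod _ bN) chinese_modr // expg_mod.
by split=> //; rewrite -(groupMl _ sH) -pa_liftE.
Qed.

(** After splitting, the subgroup contains the top group and the entries u at d and l at e;
    transitivity of [B] moves both to every coordinate, where they generate [A]. *)
Lemma pa_wreath_two_generated p N (u l : {perm Omega}) (b c : {perm Delta}) (d e : Delta) :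
  coprime p N -> u ^+ p = 1 -> l ^+ p = 1 -> b ^+ N = 1 -> c ^+ N = 1 ->
  b d = d -> c e = e -> A :=: <<[set u; l]>> -> B :=: <<[set b; c]>> ->
  (forall x y, exists2 s, s \in B & s x = y) ->
  pa_wreath A B = <<[set pa_lift d u b; pa_lift e l c]>>.
Proof.
move=> cpN up lp bN cN bd ce defA defB trB.
have sub d' x b' : x \in A -> b' \in B -> pa_lift d' x b' \in pa_wreath A B.
  move=> xA bB; apply: imset2_f => //; apply/pa_baseP=> f; rewrite ffunE.
  by case: eqP; rewrite ?group1.
apply/eqP; rewrite eqEsubset; apply/andP; split; last first.
  rewrite gen_subG; apply/subsetP=> w /set2P[]->; apply: sub; rewrite ?defA ?defB;
  by rewrite mem_gen // ?set21 ?set22.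
set H := <<_>>.
have [uH bH] := @pa_lift_split <<[set pa_lift d u b; pa_lift e l c]>>%G _ _ _ _ _ cpN up bN bd (mem_gen (set21 _ _)).
have [lH cH] := @pa_lift_split <<[set pa_lift d u b; pa_lift e l c]>>%G _ _ _ _ _ cpN lp cN ce (mem_gen (set22 _ _)).
have BH b' : b' \in B -> pa_perm [ffun=> 1] b' \in H.
  have gB : group_set [set b' : {perm Delta} | pa_perm [ffun=> 1] b' \in H].
    apply/group_setP; split=> [|x y]; rewrite !inE; first by rewrite pa_perm1 group1.
    move=> xH yH; have := groupM xH yH; rewrite pa_permM.
    by congr (pa_perm _ _ \in H); apply/ffunP=> f; rewrite !ffunE mulg1.
  have : B \subset Group gB.
    by rewrite defB gen_subG; apply/subsetP=> x /set2P[]->; rewrite inE.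
  by move/subsetP=> sB /sB; rewrite inE.
apply: pa_wreath_sub => // f x.
have tr g y : pa_single g y \in H -> pa_single f y \in H.
  by have [s sB <-] := trB g f; rewrite -pa_singleJ => yH; rewrite groupJ ?BH.
have gA : group_set [set y | pa_single f y \in H].
  apply/group_setP; split=> [|y z]; rewrite !inE ?pa_single1 ?group1 //.
  by rewrite pa_singleM; apply: groupM.
have : A \subset Group gA.
  rewrite defA gen_subG; apply/subsetP=> y /set2P[]->; rewrite inE; first exact: tr uH.
  exact: tr lH.
by move/subsetP=> sA /sA; rewrite inE.
Qed.

(** The powers of u give a copy of F_p^Delta in the base group. Each linear map from F_p^D to the
    complementary coordinates has a graph, these graphs are distinct subgroups, and the index bound
    |W| holds for every subgroup. *)
Lemma card_subgroups_pa_wreath_ge p u (D : {set Delta}) :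
  1 < #|Omega| -> prime p -> u \in A -> #[u] = p ->
  p ^ (#|~: D| * #|D|) <= #|subgroups_index_le #|pa_wreath A B| (pa_wreath A B)|.
Proof.
move=> O1 p_pr uA ou.
pose psi (x : {ffun Delta -> 'F_p}) : {perm {ffun Delta -> Omega}} :=
  pa_perm [ffun d => u ^+ (x d)] 1.
have Fpn (i j : 'F_p) : u ^+ (i + j)%R = u ^+ i * u ^+ j.
  have up : u ^+ p = 1 by rewrite -ou expg_order.
  by rewrite -[i in LHS]natr_Zp -[j in LHS]natr_Zp -GRing.natrD val_Fp_nat // expg_mod // expgD.
have psiM x y : psi x * psi y = psi [ffun d => x d + y d]%R.
  rewrite pa_permM mulg1; congr pa_perm; apply/ffunP=> d.
  by rewrite !ffunE invg1 perm1 Fpn.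
have psi0 : psi [ffun=> 0%R] = 1.
  by rewrite -pa_perm1; congr pa_perm; apply/ffunP=> d; rewrite !ffunE.
have psi_inj : injective psi.
  move=> x y /(pa_perm_inj O1)[/ffunP xy _]; apply/ffunP=> d; apply: val_inj => /=.
  have ltp (z : 'F_p) : z < p by rewrite -[X in _ < X](Fp_cast p_pr) ltn_ord.
  by have /eqP := xy d; rewrite !ffunE eq_expg_mod_order ou !modn_small // => /eqP.
pose gr (phi : {ffun Delta * Delta -> 'F_p}) : {set {ffun Delta -> 'F_p}} :=
  [set x : {ffun Delta -> 'F_p} |
    [forall d, (d \notin D) ==> (x d == \sum_(e in D) phi (d, e) * x e)%R]].
have grP (phi : {ffun Delta * Delta -> 'F_p}) (x : {ffun Delta -> 'F_p}) : reflect (forall d, d \notin D -> x d = (\sum_(e in D) phi (d, e) * x e)%R)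
                         (x \in gr phi).
  by rewrite inE; apply: (iffP forall_inP) => h d /h => [/eqP|->].
have gH phi : group_set (psi @: gr phi).
  apply/group_setP; split=> [|_ _ /imsetP[x /grP xg ->] /imsetP[y /grP yg ->]].
    rewrite -psi0; apply/imset_f/grP=> d _; rewrite ffunE big1 // => e _.
    by rewrite ffunE GRing.mulr0.
  rewrite psiM; apply/imset_f/grP=> d dD; rewrite ffunE xg // yg // -big_split /=.
  by apply: eq_bigr => e _; rewrite ffunE GRing.mulrDr.
(* Matrices supported on (~: D) x D, so that a graph determines its matrix. *)
pose T := pffun_on (0%R : 'F_p) (mem (setX (~: D) D)) predT.
have cT : #|T| = (p ^ (#|~: D| * #|D|))%N.
  by rewrite card_pffun_on cardsX (eq_card (_ : _ =i 'F_p)) ?card_Fp // => x; rewrite !inE.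
rewrite -cT -(@card_in_imset _ _ (fun phi => Group (gH phi))); last first.
  move=> phi phi' /pffun_onP[/supportP sp _] /pffun_onP[/supportP sp' _] /(congr1 val)/= eqH.
  apply/ffunP=> -[d e].
  have [/setXP[]|nde] := boolP ((d, e) \in setX (~: D) D); last by rewrite sp // sp'.
  rewrite inE => dD eD.
  (* The basis vector at e, completed to a point of the graph of [phi]; its coordinates outside [D]
     are column e of the matrix. *)
  pose x : {ffun Delta -> 'F_p} :=
    [ffun f => if f \in D then (f == e)%:R else phi (f, e)]%R.
  have sumx (f : Delta) (g : {ffun Delta * Delta -> 'F_p}) :
      (\sum_(e' in D) g (f, e') * x e' = g (f, e))%R.
    rewrite (bigD1 e) //= big1 ?GRing.addr0 => [|e' /andP[e'D /negbTE e'e]].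
      by rewrite ffunE eD eqxx GRing.mulr1.
    by rewrite ffunE e'D e'e GRing.mulr0.
  have xg : x \in gr phi.
    by apply/grP=> f fD; rewrite sumx ffunE (negbTE fD).
  have : psi x \in psi @: gr phi' by rewrite -eqH imset_f.
  case/imsetP=> x' xg' /psi_inj xx'; rewrite -xx' in xg'.
  by move/grP: xg' => /(_ d dD); rewrite sumx ffunE (negbTE dD).
apply: subset_leq_card; apply/subsetP=> _ /imsetP[phi _ ->]; rewrite inE /=.
have -> : psi @: gr phi \subset pa_wreath A B.
  apply/subsetP=> _ /imsetP[x _ ->]; apply: imset2_f; rewrite ?group1 //.
  by apply/pa_baseP=> d; rewrite ffunE groupX.
exact: dvdn_leq (cardG_gt0 (pa_wreath_group A B)) (dvdn_indexg (pa_wreath_group A B) (Group (gH phi))).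
Qed.

End WreathGeneration.

(** * Finite levels and portraits *)

Section Levels.
Local Open Scope group_scope.
Variables (Omega : nat -> finType) (S : forall k, {group {perm Omega k}}).

(** One base component for every level; truncations form a compatible sequence, so a portrait
    describes an element of the inverse limit. *)
Definition portrait := forall m, {ffun hatOmega Omega m -> {perm Omega m}}.

Fixpoint portrait_perm (a : portrait) n : {perm hatOmega Omega n} :=
  match n return {perm hatOmega Omega n} with
  | 0 => 1
  | m.+1 => pa_perm (a m) (portrait_perm a m)
  end.

Definition portrait_in (a : portrait) := forall m, a m \in pa_base (hatOmega Omega m) (S m).

Lemma portrait_perm_level a n : portrait_in a -> portrait_perm a n \in Wpa_level S n.
Proof.
move=> aS; elim: n => [|n IHn]; first exact: group1.
apply: imset2_f; [exact: aS | exact: IHn].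
Qed.

Lemma portrait_perm_proj a n : portrait_in a ->
  pa_proj (S n) (portrait_perm a n.+1) (portrait_perm a n).
Proof. by move=> aS; apply/exists_inP; exists (a n); [exact: aS | exact: eqxx]. Qed.

Lemma portrait_perm_eq a a' n : (forall m, m < n -> a m = a' m) ->
  portrait_perm a n = portrait_perm a' n.
Proof.
elim: n => //= n IHn eqa; rewrite IHn ?eqa // => m mn.
by apply: eqa; apply: ltnW.
Qed.

Lemma level_portrait n w : w \in Wpa_level S n ->
  exists2 a, portrait_in a & portrait_perm a n = w.
Proof.
elim: n w => [|n IHn] w.
  move/set1gP->; exists (fun m => [ffun=> 1]) => // m.
  by apply/pa_baseP=> d; rewrite ffunE group1.
case/imset2P=> a0 b a0S /IHn[a aS <-] ->{w b}.
exists (@dfwith _ _ a n a0) => [m|] /=.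
  by case: dfwithP.
rewrite dfwith_in; congr pa_perm; apply: portrait_perm_eq => m mn.
by rewrite dfwith_out // gtn_eqF.
Qed.

Lemma level_transitive : (forall k x y, exists2 s, s \in S k & s x = y) ->
  forall n x y, exists2 s, s \in Wpa_level S n & s x = y.
Proof.
move=> trS [|n]; last by apply: pa_wreath_transitive.
by move=> [] []; exists 1; rewrite ?group1 ?perm1.
Qed.

Section Generators.
Variables (u l : forall k, {perm Omega k}) (t t' : forall k, Omega k) (p : nat -> nat).
Hypotheses (up : forall k, u k ^+ p k = 1) (lp : forall k, l k ^+ p k = 1).
Hypotheses (ut : forall k, u k (t k) = t k) (lt' : forall k, l k (t' k) = t' k).
Hypothesis defS : forall k, S k :=: <<[set u k; l k]>>.
Hypothesis trS : forall k x y, exists2 s, s \in S k & s x = y.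
Hypothesis cop : forall k, coprime (p k) (\prod_(i < k) p i).

(* The ray along which the generator acts: at every level its only non-trivial
   entry sits at a point which it fixes. *)
Definition ray (t : forall k, Omega k) (m : nat) : hatOmega Omega m :=
  match m return hatOmega Omega m with 0 => tt | k.+1 => [ffun=> t k] end.

Definition ray_portrait (u : forall k, {perm Omega k}) (t : forall k, Omega k) : portrait :=
  fun m => [ffun e => if e == ray t m then u m else 1].

Lemma ray_portrait_in (v : forall k, {perm Omega k}) s :
  (forall k, v k \in S k) -> portrait_in (ray_portrait v s).
Proof. by move=> vS m; apply/pa_baseP=> d; rewrite ffunE; case: eqP; rewrite ?group1. Qed.

Lemma ray_fixed (v : forall k, {perm Omega k}) s n : (forall k, v k (s k) = s k) ->
  portrait_perm (ray_portrait v s) n (ray s n) = ray s n.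
Proof. by move=> vs; case: n => [|n]; [rewrite perm1|apply: pa_lift_fixed]. Qed.

(** The new entry sits at a fixed point, so powers are taken entrywise: the earlier primes kill the
    part below and [p n] kills the entry. *)
Lemma ray_expg (v : forall k, {perm Omega k}) s n : (forall k, v k (s k) = s k) ->
  (forall k, v k ^+ p k = 1) ->
  portrait_perm (ray_portrait v s) n ^+ (\prod_(i < n) p i) = 1.
Proof.
move=> vs vp; elim: n => [|n IHn]; first exact: expg1n.
rewrite big_ord_recr /= -[pa_perm _ _]/(pa_lift (ray s n) (v n) (portrait_perm (ray_portrait v s) n)).
rewrite pa_lift_expg ?ray_fixed // [portrait_perm _ _ ^+ _]expgM IHn expg1n.
have -> : v n ^+ (\prod_(i < n) p i * p n) = 1 by rewrite mulnC expgM vp expg1n.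
by rewrite -[RHS]pa_perm1; congr pa_perm; apply/ffunP=> d; rewrite !ffunE if_same.
Qed.

Lemma level_generated n : Wpa_level S n :=:
  <<[set portrait_perm (ray_portrait u t) n; portrait_perm (ray_portrait l t') n]>>.
Proof.
elim: n => [|n IHn].
  apply/esym/trivgP; rewrite gen_subG; apply/subsetP=> x.
  by move=> /set2P[]->; rewrite inE.
apply: (@pa_wreath_two_generated _ _ _ _ (p n) (\prod_(i < n) p i)) => //.
- exact: ray_expg.
- exact: ray_expg.
- exact: ray_fixed.
- exact: ray_fixed.
- exact: level_transitive.
Qed.

End Generators.

(** With q points in the new factor and m coordinates the order is at most (2 q^3)^m <= 2^(q m) <=
    2^(q^m); 13 is the first prime with 2 q^3 <= 2^q. *)
Lemma card_level_le (p : nat -> nat) :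
  (forall k, 13 <= p k) -> (forall k, p k <= #|Omega k|) ->
  (forall k, #|S k| <= p k ^ 3) ->
  forall n, #|Wpa_level S n| <= 2 ^ #|hatOmega Omega n|.
Proof.
move=> p13 pO Sp; elim=> [|n IHn]; first by rewrite cards1 expn_gt0.
apply: leq_trans (card_pa_wreath_le _ _) _.
rewrite /= card_ffun; set m := #|hatOmega Omega n| in IHn *; set q := #|Omega n|.
have q13 : 13 <= q by apply: leq_trans (p13 n) (pO n).
have Sq : #|S n| <= q ^ 3.
  by apply: leq_trans (Sp n) _; rewrite leq_exp2r // pO.
apply: leq_trans (_ : (2 ^ q) ^ m <= _).
  case: (posnP m) IHn => [->|m0] IHn; first by rewrite !expn0 mul1n.
  apply: leq_trans (leq_mul (leq_trans (_ : _ <= (q ^ 3) ^ m) (leqnn _)) IHn) _.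
    by rewrite leq_exp2r.
  rewrite -expnMn leq_exp2r //.
  have {Sq}: exists j, q = 13 + j by exists (q - 13); lia.
  case=> j ->; elim: j => // j IHj; rewrite addnS expnS.
  move: IHj; have : 13 <= 13 + j by rewrite leq_addr.
  move: (13 + j) => x x13; rewrite !expnS expn0 !muln1.
  have h1 : 13 * (x * x) <= x * (x * x) by rewrite leq_mul2r x13 orbT.
  have h2 : 13 * x <= x * x by rewrite leq_mul2r x13 orbT.
  have -> : (x.+1 * (x.+1 * x.+1) = x * (x * x) + 3 * (x * x) + 3 * x + 1)%N.
    by ring.
  lia.
rewrite -expnM leq_exp2l //; case: (m) => [|k]; first by rewrite muln0.
by rewrite expnS leq_mul2l ltn_expl ?orbT //; lia.
Qed.

End Levels.

(** * Gently growing functions and primes *)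

Section PrimesInIntervals.
Local Open Scope nat_scope.

Lemma expn2_le_central_bin n : 2 ^ n <= 'C(n + n, n).
Proof.
rewrite -binomial.Vandermonde -[2]/(1 + 1) expnDn; apply: leq_sum => i _.
rewrite !exp1n !muln1 leq_pmulr // bin_gt0; lia.
Qed.

(** By Legendre's formula the exponent is the sum over k of floor(2n/q^k) - 2 floor(n/q^k); each
    term is at most 1, and it is 0 once q^k > 2n. *)
Lemma logn_central_bin q n : prime q -> q ^ logn q 'C(n + n, n) <= maxn 1 (n + n).
Proof.
move=> q_pr; have q1 := prime_gt1 q_pr.
case: (posnP n) => [->|n0]; first by rewrite bin0 logn1.
have b0 : 0 < 'C(n + n, n) by rewrite bin_gt0 leq_addr.
have ext : logn q n`! = \sum_(1 <= k < (n + n).+1) n %/ q ^ k.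
  have n2 : n.+1 <= (n + n).+1 by rewrite ltnS leq_addr.
  rewrite logn_fact // (big_cat_nat (n := n.+1) _ n2) //=.
  rewrite [X in _ = _ + X]big1_seq ?addn0 // => k; rewrite mem_index_iota => /andP[_ /andP[nk _]].
  by rewrite divn_small //; apply: leq_trans nk _; apply/ltnW/ltn_expl.
have : logn q 'C(n + n, n) <= \sum_(1 <= k < (n + n).+1) (q ^ k <= n + n).
  have := congr1 (logn q) (bin_fact (leq_addr n n)).
  rewrite addnK !lognM ?muln_gt0 ?fact_gt0 // ext logn_fact // => e.
  rewrite -(leq_add2r (\sum_(1 <= k < (n + n).+1) n %/ q ^ k + \sum_(1 <= k < (n + n).+1) n %/ q ^ k)).
  rewrite e -!big_split /=; apply: leq_sum => k _.
  have qk : 0 < q ^ k by rewrite expn_gt0 ltnW.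
  have := divn_eq n (q ^ k); have := ltn_pmod n qk.
  move: (n %/ q ^ k) (n %% q ^ k) => a r rq en.
  case: (leqP (q ^ k) (n + n)) => h; last by rewrite divn_small.
  rewrite -ltnS ltn_divLR // {1 2}en /=; nia.
have le2 : \sum_(1 <= k < (n + n).+1) (q ^ k <= n + n) <= trunc_log q (n + n).
  apply: leq_trans (_ : \sum_(1 <= k < (n + n).+1) (k <= trunc_log q (n + n)) <= _).
    apply: leq_sum => k _; case: (leqP (q ^ k)) => //= h.
    by rewrite trunc_log_max.
  move: (trunc_log _ _) => T; elim: (n + n) => [|j IHj]; first by rewrite big_geq.
  rewrite big_nat_recr //=; case: (leqP j.+1) => jT; last by rewrite addn0.
  rewrite addn1; apply: leq_ltn_trans jT.
  apply: leq_trans (leq_sum _ (fun k _ => leq_b1 _)) _.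
  by rewrite sum_nat_const_nat muln1 subn1.
move=> le1; have vT := leq_trans le1 le2; apply: leq_trans (leq_pexp2l (ltnW q1) vT) _.
by rewrite leq_max trunc_logP ?orbT //; lia.
Qed.

(* Otherwise the binomial coefficient 'C(2n, n) with n = 4 ^ t would have at
   most 2 ^ t prime factors, each contributing at most 2n. *)
Lemma prime_between t : 3 <= t -> exists2 p, prime p & 2 ^ t <= p <= 2 ^ (2 * t + 1).
Proof.
move=> t3; pose n := 2 ^ (2 * t); have n0 : 0 < n by rewrite expn_gt0.
have nn : n + n = 2 ^ (2 * t + 1) by rewrite addn1 expnS /n; lia.
have b0 : 0 < 'C(n + n, n) by rewrite bin_gt0 leq_addr.
have [/hasP[p pP pt]|/hasPn small] := boolP (has (leq (2 ^ t)) (primes 'C(n + n, n))).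
  exists p; first by move: pP; rewrite mem_primes => /andP[].
  rewrite pt -nn /=; move: pP; rewrite mem_primes => /and3P[p_pr _ pb].
  have : p %| (n + n)`! by rewrite -(bin_fact (leq_addr n n)) dvdn_mulr.
  elim: (n + n) => [|k IHk]; first by rewrite fact0 dvdn1; have := prime_gt1 p_pr; lia.
  by rewrite factS Euclid_dvdM // => /orP[/dvdn_leq-> //|/IHk /leqW].
exfalso; have szp : size (primes 'C(n + n, n)) <= 2 ^ t.
  rewrite -(size_iota 0 (2 ^ t)); apply: uniq_leq_size; first exact: primes_uniq.
  by move=> q /small; rewrite mem_iota /= add0n -ltnNge.
have : 2 ^ n <= (n + n) ^ (2 ^ t).
  apply: leq_trans (expn2_le_central_bin n) _.
  rewrite [leqLHS]prod_prime_decomp // prime_decompE big_map /=.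
  apply: leq_trans (_ : (n + n) ^ size (primes 'C(n + n, n)) <= _); last first.
    by apply: leq_pexp2l => //; lia.
  have : {subset primes 'C(n + n, n) <= prime}.
    by move=> q; rewrite mem_primes => /andP[].
  elim: (primes _) => [|q s IHs] sp; first by rewrite big_nil.
  rewrite big_cons /= expnS leq_mul ?IHs //; last by move=> r rs; apply: sp; rewrite inE rs orbT.
  have := @logn_central_bin q n (sp q (mem_head _ _)).
  by rewrite (maxn_idPr _) //; lia.
(* The exponents now compare 2^t 2^t with (2t + 1) 2^t, impossible since 2t + 1 < 2^t for t >= 3. *)
rewrite nn -expnM leq_exp2l // /n mul2n -addnn expnD leq_pmul2r ?expn_gt0 //.
suff : 2 * t + 1 < 2 ^ t by lia.
elim: t t3 {n n0 nn b0 small szp} => // t IHt; rewrite leq_eqVlt => /orP[/eqP <- //|/IHt].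
by rewrite expnS; lia.
Qed.

End PrimesInIntervals.

From mathcomp Require Import finmap all_classical all_reals all_analysis lra.

(** * Gentle growth along powers of two *)

Section GentleGrowth.
Import Order.TTheory GRing.Theory Num.Theory.
Local Open Scope ring_scope.
Variable R : realType.
Implicit Type f : nat -> R.

Lemma ln2_ge_half : 2^-1 <= ln (2 : R).
Proof.
have h := expR_ge1Dx (- 2^-1 : R).
have {}h : 2^-1 <= expR (- 2^-1 : R) by apply: le_trans h; lra.
rewrite -[2^-1]opprK -[ln 2]opprK -lnV ?posrE // lerN2.
by rewrite -ler_expR lnK // posrE.
Qed.

(** For x = 2^t one has x^(ln x) = 2^(t^2 ln 2), and ln 2 >= 1/2. *)
Lemma gently_growing_pow2 f : gently_growing f -> exists A t0, 0 < A /\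
  forall t s, (t0 <= t)%N -> (2 * s <= t ^ 2)%N -> f (2 ^ s)%N <= A * f (2 ^ t)%N.
Proof.
move=> [_ mono _ [A [N [A0 N0 h]]]].
exists A, (Num.truncn N).+1; split=> // t s tN st.
have t2 : N <= (2 ^ t)%N%:R.
  apply/ltW; rewrite -truncn_lt_nat ?(ltW N0) //.
  by apply: leq_trans tN _; apply/ltnW/ltn_expl.
apply: le_trans (h (2 ^ t)%N _ t2); last by rewrite expn_gt0.
apply: mono; first by rewrite expn_gt0.
rewrite truncn_ge_nat ?powR_ge0 //.
have p2 k : 0 < (2 ^ k)%N%:R :> R by rewrite ltr0n expn_gt0.
rewrite -ler_ln ?posrE ?powR_gt0 // ln_powR !natrX !lnXn //.
have l2 := ln2_ge_half.
rewrite -[_ *+ s]mulr_natr -[_ *+ t]mulr_natr.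
have : s%:R * 2 <= t%:R ^+ 2 :> R by rewrite -natrM -natrX ler_nat mulnC.
have t0 : 0 <= t%:R :> R by [].
have s0 : 0 <= s%:R :> R by [].
move: (ln 2) (t%:R) (s%:R) l2 t0 s0 => l a b l2 a0 b0 ab.
rewrite mulrACA -expr2 -mulrA; apply: ler_wpM2l; first lra.
nra.
Qed.

(** Strong induction: for the least s with 2t <= s^2, f(2^t) <= A f(2^s) <= A B s, and A s <= t once
    t is large because s is about the square root of 2t. *)
Lemma gently_growing_linear f : gently_growing f -> exists B, 0 < B /\
  forall t, (0 < t)%N -> f (2 ^ t)%N <= B * t%:R.
Proof.
move=> hf; have [A [t0 [A0 h]]] := gently_growing_pow2 hf.
have [_ mono pos _] := hf.
(* Beyond [T] the least s is at least t0 and at least 2c + 3, whence 2 c s <= (s - 1)^2 < 2t. *)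
pose c := (Num.truncn A).+2; pose T := ((2 * c + 3) ^ 2 + t0 ^ 2)%N.
have cA : A <= c%:R.
  by apply/ltW; rewrite -truncn_lt_nat ?(ltW A0).
exists (f (2 ^ T)%N); split; first by apply: pos; rewrite expn_gt0.
have F0 t : 0 < f (2 ^ t)%N by apply: pos; rewrite expn_gt0.
elim/ltn_ind => t IHt t_gt0; have [tT|Tt] := leqP t T.
  apply: le_trans (_ : f (2 ^ T)%N * 1 <= _).
    by rewrite mulr1; apply: mono; rewrite ?expn_gt0 // leq_exp2l.
  by rewrite ler_wpM2l ?ler1n // ltW.
have ex : exists s, (2 * t <= s ^ 2)%N by exists (2 * t)%N; nia.
case: (ex_minnP ex) => s ts smin.
have s_lt : ((s.-1) ^ 2 < 2 * t)%N.
  rewrite ltnNge; apply/negP => /smin; case: (s) ts => [|j].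
    by rewrite exp0n // leqn0 muln_eq0 /= eqn0Ngt t_gt0.
  by rewrite /= ltnn.
have sbig : (2 * c + 3 <= s)%N.
  rewrite leqNgt; apply/negP=> lt; have : (s ^ 2 <= (2 * c + 3) ^ 2)%N by rewrite leq_exp2r // ltnW.
  rewrite /T in Tt; lia.
have st0 : (t0 <= s)%N.
  rewrite leqNgt; apply/negP=> lt; have : (s ^ 2 <= t0 ^ 2)%N by rewrite leq_exp2r // ltnW.
  rewrite /T in Tt; lia.
have cst : (c * s <= t)%N.
  have : (2 * c * s <= s.-1 ^ 2)%N by case: (s) sbig => // j; rewrite /= => ?; nia.
  by move: s_lt; move: (s.-1 ^ 2)%N => q; nia.
have c2 : (1 < c)%N by [].
have slt : (s < t)%N by nia.
apply: le_trans (h s t st0 ts) _.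
have s0 : (0 < s)%N by lia.
apply: le_trans (_ : c%:R * (f (2 ^ T)%N * s%:R) <= _).
  apply: ler_pM; rewrite ?(ltW A0) ?(ltW (F0 _)) //; exact: IHt.
rewrite mulrCA -natrM ler_wpM2l ?ler_nat //; exact: ltW.
Qed.

(** Take t1 least with f(2^t1) >= m, enlarge it to t >= L, and choose p between 2^t and 2^(2t + 1).
    Then f(p) >= m, while f(p^(5m)) is at most A f(2^(t - 1)). *)
Lemma prime_with_value f : gently_growing f -> exists C : R, 0 < C /\
  forall m, (0 < m)%N -> exists p, [/\ prime p, (13 <= p)%N, (2 ^ m <= p)%N,
    m%:R <= f p & f (p ^ (5 * m))%N <= C * m%:R].
Proof.
move=> hf; have [A [t0 [A0 h]]] := gently_growing_pow2 hf.
have [B [B0 lin]] := gently_growing_linear hf; have [unb mono pos _] := hf.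
exists (A * (1 + B * (t0 + 70)%:R)); split.
  by rewrite mulr_gt0 // ltr_pwDl // mulr_ge0 // ltW.
move=> m m0.
have ex : exists t, m%:R <= f (2 ^ t)%N.
  have [n n0 mn] := unb m%:R; exists n; apply: ltW (lt_le_trans mn _).
  by rewrite gtr0_norm ?pos // mono //; apply/ltnW/ltn_expl.
case: (ex_minnP ex) => t1 mt1 t1min.
pose L := (60 * m + t0 + 10)%N; pose t := maxn t1 L.
have tL : (L <= t)%N by rewrite leq_maxr.
have t1t : (t1 <= t)%N by rewrite leq_maxl.
have [p p_pr /andP[p1 p2]] : exists2 p, prime p & (2 ^ t <= p <= 2 ^ (2 * t + 1))%N.
  by apply: prime_between; rewrite /L in tL; lia.
have p0 := prime_gt0 p_pr.
have pm : (2 ^ m <= p)%N by apply: leq_trans p1; rewrite leq_exp2l //; rewrite /L in tL; lia.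
exists p; split=> //.
- by apply: leq_trans p1; apply: leq_trans (_ : 2 ^ 4 <= _)%N => //; rewrite leq_exp2l //; rewrite /L in tL; lia.
- by apply: le_trans mt1 _; apply: mono; rewrite ?expn_gt0 //; apply: leq_trans p1; rewrite leq_exp2l.
have le1 : f (p ^ (5 * m))%N <= f (2 ^ ((2 * t + 1) * (5 * m)))%N.
  by apply: mono; rewrite ?expn_gt0 ?p0 // [leqRHS]expnM leq_exp2r //; lia.
(* The choice of [L] ensures 10 m (2t + 1) <= (t - 1)^2; stopping at t - 1 lets the minimality of t1
   apply. *)
have le2 : f (2 ^ ((2 * t + 1) * (5 * m)))%N <= A * f (2 ^ t.-1)%N.
  by apply: h; rewrite /L in tL; [lia|case: (t) tL => //= k; nia].
apply: le_trans le1 (le_trans le2 _); rewrite -mulrA ler_wpM2l ?(ltW A0) //.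
have m1 : 1 <= m%:R :> R by rewrite ler1n.
(* Either t = t1, and f(2^(t - 1)) < m by minimality, or t = L is linear in m and the linear bound
   applies. *)
have [ltL|leL] := ltnP L t1.
  have -> : t = t1 by apply/maxn_idPl/ltnW.
  apply: le_trans (_ : m%:R <= _).
    by apply/ltW; rewrite ltNge; apply/negP => /t1min; lia.
  by rewrite ler_peMl ?ler_wpDr // mulr_ge0 // ltW.
have -> : t = L by apply/maxn_idPr.
apply: le_trans (lin L.-1 _) _; first by rewrite /L; lia.
apply: le_trans (_ : B * ((t0 + 70) * m)%:R <= _).
  by rewrite ler_wpM2l ?(ltW B0) // ler_nat /L; nia.
rewrite natrM mulrA ler_wpM2r // lerDr; exact: ler01.
Qed.

End GentleGrowth.

(** * Open subgroups of the inverse limit *)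

Section Profinite.
Local Open Scope classical_set_scope.
Local Open Scope group_scope.

Lemma card_finpred (T : finType) (P : {set T}) : ([set` P] #= `I_#|P|)%card.
Proof.
pose g (i : 'I_#|P|) : T := enum_val i.
have -> : [set` P] = g @` [set: 'I_#|P|].
  apply/seteqP; split=> [x /= xP|_ [i _ <-]]; last exact: enum_valP.
  by exists (enum_rank_in xP x) => //; rewrite /g enum_rankK_in.
have h1 : (g @` [set: 'I_#|P|] #= [set: 'I_#|P|])%card.
  by apply: inj_card_eq => i j _ _; apply: enum_val_inj.
have h2 : ([set: 'I_#|P|] #= `I_#|P|)%card by rewrite card_eq_sym card_II.
exact: card_eq_trans h1 h2.
Qed.

Lemma card_le_finpred (T : finType) (P : {set T}) n :
  ([set` P] #<= `I_n)%card -> #|P| <= n.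
Proof.
move=> h; rewrite -card_le_II; apply: card_le_trans h.
by have := card_finpred P; rewrite card_eq_le => /andP[].
Qed.

Variables (Omega : nat -> finType) (S : forall k, {group {perm Omega k}}).
Hypothesis Omega_gt1 : forall k, 1 < #|Omega k|.
Let W : profiniteGroupType := Wpa S.
Implicit Types (x y : W) (H : set W).

Lemma coord_level n x : Wpa_coord n x \in Wpa_level S n.
Proof. by have [] := set_mem (valP x) n. Qed.

Lemma coordM n x y : Wpa_coord n (x * y) = (Wpa_coord n x : {perm _}) * Wpa_coord n y.
Proof. by []. Qed.

Lemma coordV n x : Wpa_coord n x^-1 = (Wpa_coord n x : {perm _})^-1.
Proof. by []. Qed.

Lemma Wpa_portrait (a : portrait Omega) : portrait_in S a ->
  exists x : W, forall n, Wpa_coord n x = portrait_perm a n.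
Proof.
move=> aS; have aW : (portrait_perm a : Wpa_prod Omega) \in Wpa_set S.
  apply/mem_set => n; split; first exact: portrait_perm_level.
  exact: portrait_perm_proj.
by exists (exist (fun z : Wpa_prod Omega => z \in Wpa_set S) _ aW).
Qed.

Lemma coord_surj n w : w \in Wpa_level S n -> exists x : W, Wpa_coord n x = w.
Proof.
by case/level_portrait=> a /Wpa_portrait[x xE] <-; exists x.
Qed.

Lemma coord_eq_le m n x y : m <= n -> Wpa_coord n x = Wpa_coord n y ->
  Wpa_coord m x = Wpa_coord m y.
Proof.
elim: n => [|n IHn]; first by rewrite leqn0 => /eqP->.
rewrite leq_eqVlt ltnS => /predU1P[->//|mn] xy; apply: IHn => //.
have [_ px] := set_mem (valP x) n; have [_ py] := set_mem (valP y) n.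
apply: pa_proj_unique px _ => //.
by rewrite -[\val x _]/(Wpa_coord n.+1 x) xy.
Qed.

(** The sets containing a cylinder around x form a filter, since higher coordinates determine lower
    ones, and this filter converges to x. *)
Lemma nbhs_cylinder x (U : set W) : nbhs x U ->
  exists n, forall y, Wpa_coord n y = Wpa_coord n x -> U y.
Proof.
pose F : set_system W :=
  [set V | exists n, forall y, Wpa_coord n y = Wpa_coord n x -> V y].
have FF : Filter F.
  split.
  - by exists 0.
  - move=> V1 V2 [n1 h1] [n2 h2]; exists (maxn n1 n2) => y xy; split.
      by apply: h1; apply: coord_eq_le xy; rewrite leq_maxl.
    by apply: h2; apply: coord_eq_le xy; rewrite leq_maxr.
  - by move=> V1 V2 sV [n h]; exists n => y /h /sV.
have : F --> x by apply: Wpa_cvg => n; exists n.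
by move=> h /h.
Qed.

Lemma open_coord_preimage n (K : {set {perm hatOmega Omega n}}) :
  open ([set x : W | Wpa_coord n x \in K]).
Proof. have h := @Wpa_coord_open Omega S n [set z | z \in K]; exact h. Qed.

Definition coord_image n H : {set {perm hatOmega Omega n}} :=
  [set w | `[< exists2 x, H x & Wpa_coord n x = w >]].

Lemma coord_imageP n H w :
  reflect (exists2 x, H x & Wpa_coord n x = w) (w \in coord_image n H).
Proof. by rewrite inE; apply: asboolP. Qed.

Lemma coord_image_group_set n H : @is_subgroup W H -> group_set (coord_image n H).
Proof.
move=> [H1 HM _]; apply/group_setP; split.
  by apply/coord_imageP; exists 1.
move=> _ _ /coord_imageP[x xH <-] /coord_imageP[y yH <-].
by apply/coord_imageP; exists (x * y); rewrite ?coordM //; apply: HM.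
Qed.

Lemma coord_image_sub n H : coord_image n H \subset Wpa_level S n.
Proof. by apply/fintype.subsetP=> _ /coord_imageP[x _ <-]; apply: coord_level. Qed.

(** The abstract subgroup generated by b and c maps onto every level, so it meets every cylinder. *)
Lemma topologically_two_generated (b c : W) :
  (forall n, Wpa_level S n :=: <<[set (Wpa_coord n b : {perm hatOmega Omega n}); Wpa_coord n c]%SET>>) ->
  topologically_fg W.
Proof.
move=> gen; exists ([set b] `|` [set c]); first by rewrite finite_setU; split; apply: finite_set1.
set K := smallest _ _; have KG : @is_subgroup W K.
  split.
  - by move=> A [[]].
  - by move=> x y Kx Ky A AA; have [[_ AM _] _] := AA; apply: AM; [exact: Kx|exact: Ky].
  - by move=> x Kx A AA; have [[_ _ AV] _] := AA; apply: AV; exact: Kx.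
have Kbc x : ([set b] `|` [set c]) x -> K x by move=> xbc A [_ sA]; apply: sA.
apply/seteqP; split=> // x _ U /nbhs_cylinder[n nU].
have : Wpa_coord n x \in Group (coord_image_group_set n KG).
  apply: (fintype.subsetP _ _ (coord_level n x)); rewrite gen gen_subG.
  apply/fintype.subsetP=> w /set2P[]->; apply/coord_imageP.
    by exists b => //; apply: Kbc; left.
  by exists c => //; apply: Kbc; right.
case/coord_imageP=> y Ky xy; exists y; split => //; exact: nU.
Qed.

Lemma index_coord_image n N H (HG : @is_subgroup W H) :
  (left_cosets H #<= `I_N)%card ->
  #|Wpa_level S n : Group (coord_image_group_set n HG)| <= N.
Proof.
move=> cH; rewrite -card_lcosets; apply: card_le_finpred; apply: card_le_trans cH.
pose F (C : set W) : {set {perm hatOmega Omega n}} := coord_image n C.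
apply: card_le_trans (card_image_le F (left_cosets H)); apply: subset_card_le => C /=.
case/lcosetsP=> w wW ->{C}; have [x xw] := coord_surj wW.
exists [set x * h | h in H]; first by exists x.
apply/setP=> v; apply/coord_imageP/lcosetP => [[_ [h Hh <-] <-]|[v' /coord_imageP[h Hh <-] ->]].
  by exists (Wpa_coord n h); [apply/coord_imageP; exists h | rewrite coordM xw].
by exists (x * h); [exists h | rewrite coordM xw].
Qed.

Lemma coord_preimage_open_subgroup n N (K : {group {perm hatOmega Omega n}}) :
  #|Wpa_level S n : K| <= N ->
  @open_subgroups W N [set x | Wpa_coord n x \in K].
Proof.
move=> iK; have HG : @is_subgroup W [set x | Wpa_coord n x \in K].
  split=> [|x y|x] /=; first exact: group1.
    exact: groupM.
  by rewrite coordV groupV.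
split=> //; first exact: open_coord_preimage.
pose F (C : {set {perm hatOmega Omega n}}) : set W := [set x | Wpa_coord n x \in C].
apply: (@card_le_trans _ _ _ [set` lcosets K (Wpa_level S n)]); last first.
  apply: card_le_trans (_ : (_ #<= `I_N)%card).
    by have := card_finpred (lcosets K (Wpa_level S n)); rewrite card_eq_le => /andP[h _]; exact: h.
  by rewrite card_lcosets card_le_II.
apply: card_le_trans (card_image_le F _); apply: subset_card_le => _ [x _ <-].
exists ((Wpa_coord n x : {perm hatOmega Omega n}) *: K).
  by apply/lcosetsP; exists (Wpa_coord n x) => //; exact: coord_level.
apply/seteqP; split=> y /=; rewrite /F /=.
  move=> yx; exists (x^-1 * y); last by rewrite mulKVg.
  by rewrite /= coordM coordV -mem_lcoset.
by case=> h Kh <-; rewrite coordM mem_lcoset mulKg.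
Qed.

End Profinite.

(** * Reducing the count of open subgroups to a finite level *)

Section SubgroupCount.
Local Open Scope classical_set_scope.
Local Open Scope group_scope.
Variables (Omega : nat -> finType) (S : forall k, {group {perm Omega k}}).
Hypothesis Omega_gt1 : forall k, 1 < #|Omega k|.
Variables (p : nat -> nat) (u l : forall k, {perm Omega k}).
Hypothesis p_pr : forall k, prime (p k).
Hypothesis defS : forall k, S k :=: <<[set u k; l k]%SET>>.
Hypotheses (up : forall k, u k ^+ p k = 1) (lp : forall k, l k ^+ p k = 1).
Let W : profiniteGroupType := Wpa S.
Implicit Types (x y : W) (H : set W).

(* Descending from a level whose kernel lies in H, each base group is
   generated by elements of prime order larger than the index of H. *)
Lemma level_kernel_sub N k H : @open_subgroups W N H -> (forall j, k <= j -> N < p j) ->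
  forall x, Wpa_coord k x = 1 -> H x.
Proof.
move=> [HG oH cH] Np; have [H1 HM HV] := HG.
have [|n] := @nbhs_cylinder _ S Omega_gt1 1 H; first exact: open_nbhs_nbhs.
elim: n => [|n IHn] nH x xk.
  by apply: nH; apply: (coord_eq_le Omega_gt1 (leq0n k)); rewrite xk.
have [nk|kn] := ltnP n k.
  by apply: nH; apply: (coord_eq_le Omega_gt1 nk); rewrite xk.
apply: IHn xk => {}x xn.
(* Being trivial at level n, x lies in the base group at level n + 1, where index less than [p n]
   forces it into the image of H. *)
have xB : Wpa_coord n.+1 x \in pa_partial_base (S n) [set: hatOmega Omega n]%SET.
  have [_] := set_mem (valP x) n; case/exists_inP=> a aS /eqP xa.
  apply/pa_partial_baseTP; exists a => //; rewrite -[LHS]/(\val x n.+1) xa.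
  by congr (pa_perm _ _); exact: xn.
have sB := @pa_base_sub_small_index _ _ (S n) (Wpa_level S n) (p n) (u n) (l n)
  (Group (coord_image_group_set n.+1 HG)) (p_pr n) (defS n) (up n) (lp n)
  (coord_image_sub n.+1 H).
have idx : #|pa_wreath (S n) (Wpa_level S n) : Group (coord_image_group_set n.+1 HG)| < p n.
  have h := @index_coord_image Omega S n.+1 N H HG cH. 
  exact: (leq_ltn_trans h (Np n kn)).
have : Wpa_coord n.+1 x \in coord_image n.+1 H.
  exact: (fintype.subsetP (sB idx) _ xB).
case/coord_imageP=> y Hy yx.
rewrite -(mulKVg y x); apply: HM => //; apply: nH.
by rewrite coordM coordV yx mulVg.
Qed.

Definition coord_preimage k (K : {group {perm hatOmega Omega k}}) : set W :=
  [set x | Wpa_coord k x \in K].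

Lemma card_coord_preimage N k :
  (coord_preimage (k := k) @` [set` subgroups_index_le N (Wpa_level S k)] #=
   `I_#|subgroups_index_le N (Wpa_level S k)|)%card.
Proof.
apply: card_eq_trans (card_finpred _); apply: inj_card_eq => K K'.
have sub (A B : {group {perm hatOmega Omega k}}) :
    A \subset Wpa_level S k -> coord_preimage A = coord_preimage B -> A \subset B.
  move=> sAW eqAB; apply/fintype.subsetP=> w wA.
  have [x xw] := coord_surj (fintype.subsetP sAW w wA).
  have : coord_preimage A x by rewrite /coord_preimage /= xw.
  by rewrite eqAB /coord_preimage /= xw.
rewrite !inE /= !inE => /andP[sK _] /andP[sK' _] eqK.
by apply/val_inj/eqP; rewrite finset.eqEsubset (sub _ _ sK eqK) (sub _ _ sK' (esym eqK)).
Qed.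

Lemma coord_preimage_open N k :
  coord_preimage (k := k) @` [set` subgroups_index_le N (Wpa_level S k)] `<=`
  @open_subgroups W N.
Proof.
move=> _ [K + <-]; rewrite /= inE => /andP[_ iK].
exact: coord_preimage_open_subgroup.
Qed.

(** Such a subgroup contains the kernel of the k-th coordinate, so it is the full preimage of its
    image. *)
Lemma open_subgroups_level N k : (forall j, k <= j -> N < p j) ->
  @open_subgroups W N =
  coord_preimage (k := k) @` [set` subgroups_index_le N (Wpa_level S k)].
Proof.
move=> Np; apply/seteqP; split; last exact: coord_preimage_open.
move=> H oH; have ker := level_kernel_sub oH Np; case: oH => HG _ cH.
have [H1 HM HV] := HG.
exists (Group (coord_image_group_set k HG)).
  by rewrite /= inE coord_image_sub /= index_coord_image.
apply/seteqP; split=> x; last by move=> Hx; apply/coord_imageP; exists x.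
move=> /coord_imageP[y Hy yx]; rewrite -(mulKVg y x); apply: HM => //; apply: ker.
by rewrite coordM coordV yx mulVg.
Qed.

Lemma subgroup_count_level N k : (forall j, k <= j -> N < p j) ->
  subgroup_count W N = #|subgroups_index_le N (Wpa_level S k)|.
Proof.
move=> Np; rewrite /subgroup_count (open_subgroups_level Np).
exact/card_fset_set/card_coord_preimage.
Qed.

(** Preimages of distinct subgroups are distinct. Comparing cardinals also requires finitely many
    open subgroups of index at most N, which a level k' with all later primes above N provides. *)
Lemma subgroup_count_ge_level N k : (forall i, exists k', forall j, k' <= j -> i < p j) ->
  #|subgroups_index_le N (Wpa_level S k)| <= subgroup_count W N.
Proof.
move=> /(_ N)[k' Np]; apply: leq_card_fset_set.
  by rewrite (open_subgroups_level Np); exists #|subgroups_index_le N (Wpa_level S k')|; apply: card_coord_preimage.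
have := card_coord_preimage N k; rewrite card_eq_le => /andP[_ h].
apply: card_le_trans h _; apply: subset_card_le; exact: coord_preimage_open.
Qed.

End SubgroupCount.

Import Order.TTheory GRing.Theory Num.Theory.

(** * Iterated wreath products of the groups PSL_2(p_k) *)

Section IteratedPSL2.
Local Open Scope nat_scope.
Variable p : nat -> nat.
Hypotheses (p_pr : forall k, prime (p k)) (p13 : forall k, 13 <= p k).
Let Omega k := P1 'F_(p k).
Let S k := PSL2_P1_group 'F_(p k).
Let W : profiniteGroupType := Wpa S.
Let m k := #|hatOmega Omega k|.
Hypothesis pm : forall k, 2 ^ m k <= p k.

Lemma psl2_Omega_gt1 k : 1 < #|Omega k|.
Proof. exact: card_P1_gt1. Qed.

Lemma psl2_p_le_next_card k : p k <= m k.+1.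
Proof.
rewrite /m /= card_ffun; apply: leq_trans (leq_card_P1 (p_pr k)) _.
have O1 := psl2_Omega_gt1 k; rewrite -/(Omega k).
suff m0 : 0 < m k by rewrite -[leqLHS]expn1 leq_pexp2l //; apply: ltnW.
apply/card_gt0P; elim: k {O1} => [|k [x _]]; first by exists tt.
have /card_gt0P[y _] : 0 < #|Omega k| by apply: ltnW; apply: psl2_Omega_gt1.
by exists [ffun=> y].
Qed.

Lemma psl2_p_ltS k : p k < p k.+1.
Proof.
apply: leq_ltn_trans (psl2_p_le_next_card k) _; apply: leq_trans (pm k.+1); exact: ltn_expl.
Qed.

Lemma psl2_p_lt i j : i < j -> p i < p j.
Proof.
elim: j => // j IHj; rewrite ltnS leq_eqVlt => /predU1P[->|/IHj h]; first exact: psl2_p_ltS.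
exact: ltn_trans h (psl2_p_ltS j).
Qed.

Lemma psl2_lt_p k : k < p k.
Proof.
elim: k => [|k IHk]; first exact: prime_gt0.
exact: leq_ltn_trans IHk (psl2_p_ltS k).
Qed.

Lemma psl2_coprime k : coprime (p k) (\prod_(i < k) p i).
Proof.
apply: (big_ind (coprime (p k))) => [|a b|i _]; first exact: coprimen1.
  by rewrite coprimeMr => -> ->.
by rewrite prime_coprime // dvdn_prime2 // gtn_eqF // psl2_p_lt.
Qed.

Lemma psl2_p_unbounded n : exists k, forall j, k <= j -> n < p j.
Proof.
by exists n => j nj; apply: leq_ltn_trans nj (psl2_lt_p j).
Qed.

Lemma psl2_transitive k (x y : Omega k) : exists2 s, s \in S k & s x = y.
Proof.
have := atransP2 (PSL2_P1_transitive 'F_(p k)) (finset.in_setT x) (finset.in_setT y).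
by case=> s sS ->; exists s.
Qed.

Lemma psl2_generators : exists (u l : forall k, {perm Omega k}) (t t' : forall k, Omega k),
  [/\ forall k, S k :=: <<[set u k; l k]%SET>>%g,
      forall k, (u k ^+ p k = 1)%g, forall k, (l k ^+ p k = 1)%g &
      [/\ forall k, u k (t k) = t k, forall k, l k (t' k) = t' k & forall k, u k <> 1%g]].
Proof.
pose T k := (({perm Omega k} * {perm Omega k}) * (Omega k * Omega k))%type.
have ex k : exists z : T k, [/\ S k :=: <<[set z.1.1; z.1.2]%SET>>%g,
    (z.1.1 ^+ p k = 1)%g, (z.1.2 ^+ p k = 1)%g &
    [/\ z.1.1 z.2.1 = z.2.1, z.1.2 z.2.2 = z.2.2 & z.1.1 <> 1%g]].
  have [u [l [defS up lp u1 [[t ut] [t' lt]]]]] := PSL2_generators (p_pr k).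
  by exists ((u, l), (t, t')).
pose z k := projT1 (cid (ex k)); have zP k := projT2 (cid (ex k)).
exists (fun k => (z k).1.1), (fun k => (z k).1.2), (fun k => (z k).2.1), (fun k => (z k).2.2).
split=> [k|k|k|]; try by case: (zP k).
by split=> k; case: (zP k) => _ _ _ [].
Qed.

Lemma psl2_topologically_fg : topologically_fg W.
Proof.
have [u [l [t [t' [defS up lp [ut lt _]]]]]] := psl2_generators.
have uS k : u k \in S k by rewrite defS mem_gen // finset.set21.
have lS k : l k \in S k by rewrite defS mem_gen // finset.set22.
have [b bE] := Wpa_portrait (ray_portrait_in t uS).
have [c cE] := Wpa_portrait (ray_portrait_in t' lS).
apply: (topologically_two_generated psl2_Omega_gt1 (b := b) (c := c)) => n.
rewrite bE cE; apply: (level_generated up lp ut lt defS); first exact: psl2_transitive.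
exact: psl2_coprime.
Qed.

Lemma psl2_card_level k : #|Wpa_level S k| <= 2 ^ m k.
Proof.
apply: (card_level_le p13) => j; first exact: leq_card_P1.
exact: card_PSL2_le.
Qed.

(** All primes from level k + 1 on exceed n, so only that level counts; 34 = 4 * 8 + 2 comes from
    the eight generators of subgroups of PSL_2. *)
Lemma psl2_count_le k n : p k <= n < p k.+1 -> subgroup_count W n <= n ^ (34 * m k).
Proof.
move=> /andP[pn np]; have [u [l [t [t' [defS up lp _]]]]] := psl2_generators.
rewrite (subgroup_count_level psl2_Omega_gt1 p_pr defS up lp (k := k.+1)); last first.
  move=> j; rewrite leq_eqVlt => /predU1P[<-//|/psl2_p_lt]; exact: ltn_trans.
apply: (card_subgroups_pa_wreath (s := 8) (psl2_Omega_gt1 k)).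
- move=> L; apply: PSL2_generated => //; exact: leq_trans (p13 k).
- by apply: leq_trans (card_PSL2_le (p_pr k)) _; rewrite leq_exp2r.
- exact: psl2_card_level.
- exact: leq_trans (pm k) pn.
Qed.

(** Below, transitivity gives at least as many elements as points; above, the order is at most
    p^(3m) 2^m. *)
Lemma psl2_level_bounds k : k < #|Wpa_level S k.+1| <= p k ^ (5 * m k).
Proof.
apply/andP; split.
  apply: leq_trans (psl2_lt_p k) _; apply: leq_trans (psl2_p_le_next_card k) _.
  have [u [l [t [t' _]]]] := psl2_generators.
  rewrite /m -cardsT; pose x := ray t k.+1.
  apply: leq_trans (leq_imset_card (fun w : {perm hatOmega Omega k.+1} => w x) _).
  apply: subset_leq_card; apply/fintype.subsetP=> y _.
  have [s sW <-] := level_transitive psl2_transitive x y.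
  by apply/imsetP; exists s.
apply: leq_trans (card_pa_wreath_le _ _) _; rewrite -/(m k).
apply: leq_trans (_ : p k ^ (3 * m k) * p k ^ m k <= _).
  apply: leq_mul.
    rewrite expnM; case: (posnP (m k)) => [->//|m0]; rewrite leq_exp2r //.
    exact: card_PSL2_le.
  apply: leq_trans (psl2_card_level k) _.
  case: (posnP (m k)) => [->//|m0]; rewrite leq_exp2r //; exact: prime_gt1.
rewrite -expnD leq_pexp2l ?prime_gt0 //; lia.
Qed.

(** Let [D] be half of the coordinates, so that |D| (m - |D|) >= m^2/8; raising to the 8th power
    keeps the estimate in the integers. For m <= 1 this half is empty. *)
Lemma psl2_count_ge k : p k ^ (m k * m k) <=
  subgroup_count W #|Wpa_level S k.+1| ^ 8 \/ m k <= 1.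
Proof.
have [m1|m1] := leqP (m k) 1; [by right|left].
have [u [l [t [t' [defS up lp [_ _ u1]]]]]] := psl2_generators.
have h := subgroup_count_ge_level psl2_Omega_gt1 p_pr defS up lp
  #|Wpa_level S k.+1| k.+1 psl2_p_unbounded.
have uS : u k \in S k by rewrite defS mem_gen // finset.set21.
have ou : #[u k]%g = p k by apply: (nt_prime_order (p_pr k) (up k)); apply/eqP; apply: u1.
pose D := [set x in take (m k)./2 (enum (hatOmega Omega k))]%SET.
have cD : #|D| = (m k)./2.
  rewrite cardsE; have /card_uniqP -> : uniq (take (m k)./2 (enum (hatOmega Omega k))).
    exact/take_uniq/enum_uniq.
  by rewrite size_takel // -cardE -/(m k) -divn2 leq_div.
have cD' : #|~: D|%SET = m k - (m k)./2 by rewrite cardsCs finset.setCK cD.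
have {}h := leq_trans (card_subgroups_pa_wreath_ge (Wpa_level S k) D (psl2_Omega_gt1 k) (p_pr k) uS ou) h.
apply: leq_trans (_ : (p k ^ (#|~: D|%SET * #|D|)) ^ 8 <= _); last by rewrite leq_exp2r.
rewrite -expnM leq_pexp2l ?prime_gt0 // cD cD'.
have key M a : 0 < a -> M = 2 * a \/ M = 2 * a + 1 -> M * M <= (M - a) * a * 8.
  move=> a0 [->|->].
    have -> : 2 * a - a = a by lia.
    lia.
  have -> : 2 * a + 1 - a = a + 1 by lia.
  lia.
apply: key; first by rewrite half_gt0.
by have := odd_double_half (m k); case: odd => /=; lia.
Qed.

End IteratedPSL2.

(** * Choice of the primes and the growth type *)

Local Open Scope ring_scope.

Lemma powR_exponent_split (R : realType) (q m : nat) :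
  ((q ^ (5 * m))%N%:R : R) `^ (m%:R / 40) = (q ^ (m * m))%N%:R `^ 8^-1.
Proof.
rewrite (natrX _ _ (5 * m)) (natrX _ _ (m * m)).
rewrite -(powR_mulrn (5 * m) (ler0n R q)) -(powR_mulrn (m * m) (ler0n R q)) -!powRrM.
congr (_ `^ _); rewrite (natrM _ 5) (natrM _ m); set x := m%:R.
by field.
Qed.

Theorem theorem1 (R : realType) (f : nat -> R) (hf : gently_growing f) :
  exists p : nat -> nat,
    (forall k, prime (p k)) /\
    has_subgroup_growth_type
      (Wpa (fun k => PSL2_P1_group 'F_(p k)))
      (fun n => n%:R `^ f n).
Proof.
have [C [C0 ex]] := prime_with_value hf; have [_ mono pos _] := hf.
have /choice[next nextP] : forall m, exists q, (0 < m)%N ->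
    [/\ prime q, (13 <= q)%N, (2 ^ m <= q)%N, m%:R <= f q & f (q ^ (5 * m))%N <= C * m%:R].
  by move=> m; have [->|/ex[q qP]] := posnP m; [exists 0%N | exists q].
(* The prime at level k depends on the number of points of that level, hence on the earlier primes;
   so the numbers of points are defined first, by recursion, and the primes read off. *)
pose mm := fix mm k := if k is j.+1 then (#|P1 'F_(next (mm j))| ^ mm j)%N else 1%N.
have mm0 k : (0 < mm k)%N.
  by elim: k => //= k IHk; rewrite expn_gt0 (ltnW (card_P1_gt1 _)).
pose p k := next (mm k); exists p.
have p_pr k : prime (p k) by case: (nextP _ (mm0 k)).
have p13 k : (13 <= p k)%N by case: (nextP _ (mm0 k)).
have mE k : #|hatOmega (fun k => P1 'F_(p k)) k| = mm k.
  by elim: k => [|k IHk]; rewrite ?card_unit //= card_ffun IHk.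
have pm k : (2 ^ #|hatOmega (fun k => P1 'F_(p k)) k| <= p k)%N.
  by rewrite mE; case: (nextP _ (mm0 k)).
have fge k : (mm k)%:R <= f (p k) by case: (nextP _ (mm0 k)).
have fle k : f (p k ^ (5 * mm k))%N <= C * (mm k)%:R by case: (nextP _ (mm0 k)).
split=> //; split; first exact: psl2_topologically_fg.
(* For the lower bound, f(n) <= C m gives f(n)/(40 C) <= m/40, and n <= p^(5m) turns n^(m/40) into
   at most p^(m^2/8). *)
exists 34, (40 * C)^-1; split; rewrite ?invr_gt0 ?mulr_gt0 //.
  near=> n.
  have p0n : (p 0 <= n)%N by near: n; exact: nbhs_infty_ge.
  have exk : exists k, (n < p k.+1)%N.
    by exists n; apply: ltn_trans (ltnSn n) (psl2_lt_p p_pr pm n.+1).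
  (* The least such k also satisfies p_k <= n; for k = 0 this is the assumption n >= p_0. *)
  case: (ex_minnP exk) => k nk kmin.
  have kn : (p k <= n)%N.
    by case: k nk kmin => // k nk kmin; rewrite leqNgt; apply/negP => /kmin; rewrite ltnn.
  have n1 : (1 < n)%N by apply: leq_trans kn; exact: prime_gt1.
  have := @psl2_count_le p p_pr p13 pm k n; rewrite kn nk mE => /(_ isT) cnt.
  apply: le_trans (_ : (n ^ (34 * mm k))%:R <= _); first by rewrite ler_nat.
  rewrite natrX -powR_mulrn // -powRrM ler_powR ?ler1n ?(ltnW n1) //.
  rewrite natrM mulrC ler_wpM2r //; apply: le_trans (fge k) _.
  by apply: mono => //; apply: prime_gt0.
pose V := Wpa_level (fun k => PSL2_P1_group 'F_(p k)).
(* Were the set a finite [X], take k larger than max X; the order of level k + 1 exceeds k and yet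
   satisfies the inequality, a contradiction. *)
case/finite_fsetP=> X eqX; pose M := (\max_(i <- X) i)%N; pose k := M.+1.
have /andP[kn np] := psl2_level_bounds p_pr p13 pm k; set n := #|V k.+1| in kn np.
rewrite mE in np.
have n0 : (0 < n)%N by apply: leq_ltn_trans kn.
suff nX : n \in X.
  have nM : (n <= M)%N by apply: (@leq_bigmax_seq _ _ xpredT id).
  by move: kn; rewrite ltnNge /k ltnW // ltnS.
suff : [set n : nat | (n%:R `^ f n) `^ (40 * C)^-1 <=
    (subgroup_count (Wpa (fun k => PSL2_P1_group 'F_(p k))) n)%:R]%classic n by rewrite eqX.
have := psl2_count_ge p_pr pm k; rewrite mE -/(V k.+1) -/n => -[cnt|m1]; last first.
  (* As k > 0, level k has at least 13 points, which excludes m <= 1. *)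
  have := psl2_p_le_next_card p_pr M; rewrite mE => h.
  by have := leq_trans (leq_trans (p13 M) h) m1.
have p1 : (1 < p k)%N by apply: prime_gt1.
have pR : 1 <= (p k)%:R :> R by rewrite ler1n ltnW.
rewrite /= -powRrM.
apply: le_trans (_ : n%:R `^ ((mm k)%:R / 40) <= _).
  rewrite ler_powR ?ler1n //; apply: le_trans (_ : C * (mm k)%:R * (40 * C)^-1 <= _).
    rewrite ler_wpM2r ?invr_ge0 ?mulr_ge0 ?(ltW C0) //; apply: le_trans (fle k).
    exact: mono.
  suff -> : C * (mm k)%:R * (40 * C)^-1 = (mm k)%:R / 40 by [].
  by field; rewrite lt0r_neq0.
apply: le_trans (_ : ((p k ^ (5 * mm k))%:R) `^ ((mm k)%:R / 40) <= _).
  by rewrite ge0_ler_powR ?nnegrE ?divr_ge0 // ler_nat.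
rewrite powR_exponent_split.
apply: le_trans (_ : ((subgroup_count (Wpa (fun k => PSL2_P1_group 'F_(p k))) n ^ 8)%:R) `^ (8^-1) <= _).
  by rewrite ge0_ler_powR ?nnegrE ?invr_ge0 // ler_nat.
by rewrite natrX -powR_mulrn // -powRrM divff ?powRr1.
Unshelve. all: by end_near.
Qed.
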